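(* Let $r>0$, $k_{\max}>0$, let $N\ge1$ be an integer with $N<k_{\max}/\pi$, and let $M>0$ and $0<\varepsilon<1$. There exists a constant $\xi_{N,k_{\max}}$, depending only on $N,k_{\max},r,M,\varepsilon$, such that for all real-valued $h,h_{\mathrm{app}}\in H^1(\Omega_r)$ with $\|h\|_{H^1(\Omega_r)}\le M$ and $\|h_{\mathrm{app}}\|_{H^1(\Omega_r)}\le M$, with data $d=(\Gamma(h_n))_n$ and $d_{\mathrm{app}}=(\Gamma(h_{n,\mathrm{app}}))_n$, where the $n$-th components $d_n$, $d_{n,\mathrm{app}}$ are considered on the interval $\left(n\pi,k_{\max}+\sqrt{k_{\max}^2-n^2\pi^2}\right)$, one has $$\|h-h_{\mathrm{app}}\|_{L^2(\Omega_r)}^2\le\xi_{N,k_{\max}}(N+1)^{\varepsilon}\|d-d_{\mathrm{app}}\|_{\ell^2(\mathrm H)}^{2-2\varepsilon}+\frac4\pi\|d-d_{\mathrm{app}}\|_{\ell^2(\mathrm H)}^2+\frac{8\pi(N+1)}{k_{\max}^2}M^2+\frac{4}{N^2\pi^2}M^2 .$$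
   Context: $\Omega_r=(-r,r)\times(0,1)$. Let $\varphi_0=1$ and $\varphi_n(y)=\sqrt2\cos(n\pi y)$ for $n\ge1$ (an orthonormal basis of $L^2(0,1)$). The modes of $h$ are $h_n(x)=\int_0^1h(x,y)\varphi_n(y)\,dy$, so $h(x,y)=\sum_{n\ge0}h_n(x)\varphi_n(y)$; similarly $h_{n,\mathrm{app}}$ for $h_{\mathrm{app}}$. Functions on $(-r,r)$ are extended by $0$ to $\mathbb R$, and $\Gamma(f)(\omega)=\frac{i}{2\omega}\int_{\mathbb R} f(z)e^{i\omega z}\,dz$ for $\omega>0$. The norm of the data is $$\|d-d_{\mathrm{app}}\|_{\ell^2(\mathrm H)}^2=\sum_{n=0}^N\int_{n\pi}^{k_{\max}+\sqrt{k_{\max}^2-n^2\pi^2}}\omega^2|d_n(\omega)-d_{n,\mathrm{app}}(\omega)|^2\,d\omega .$$ *)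

(* Defs.v *)
From HB Require Import structures.
From mathcomp Require Import all_boot all_order all_algebra complex.
From mathcomp Require Import all_classical all_reals all_analysis.

Set Implicit Arguments.
Unset Strict Implicit.
Unset Printing Implicit Defensive.
Import Order.TTheory GRing.Theory Num.Theory.
Import numFieldNormedType.Exports.

Local Open Scope classical_set_scope.
Local Open Scope ring_scope.

Definition leb2 (R : realType) :
    {measure set (measurableTypeR R * measurableTypeR R) -> \bar R} :=
  (@lebesgue_measure R \x @lebesgue_measure R)%E.
Arguments leb2 R : clear implicits.

Definition Omega (R : realType) (r : R) : set (R * R) :=
  `]- r, r[%classic `*` `]0, 1[%classic.

Section L2.
Context {R : realType}.
Implicit Types (D : set (R * R)) (f : R * R -> R).

(* Only the values on D matter: f \_ D is f on D and 0 elsewhere.  Elements of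
   L^2(D) are represented by Borel functions, which meet every class modulo
   a.e. equality of Lebesgue measurable functions. *)
Definition inL2 D f : Prop := f \_ D \in Lfun (leb2 R) 2%:E.

Definition L2norm D f : R := fine ('N[leb2 R]_2%:E [EFin \o (f \_ D)])%E.

End L2.

Section Sobolev.
Context {R : realType}.
Implicit Types (D : set (R * R)) (f g u : R * R -> R) (i : bool).

(* true stands for the first coordinate, false for the second. *)
Definition basis i : R * R := if i then (1, 0) else (0, 1).

Definition partial i u : R * R -> R := fun p => 'D_(basis i) u p.

Definition iter_partial (s : seq bool) u : R * R -> R := foldr partial u s.

Definition smooth u : Prop :=
  forall s : seq bool, continuous (iter_partial s u) /\
    forall i p, derivable (iter_partial s u) p (basis i).

Definition support_set u : set (R * R) := closure [set p | u p != 0].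

Definition test_function D u : Prop :=
  [/\ smooth u, compact (support_set u) & support_set u `<=` D].

Definition is_weak_partial D i f g : Prop :=
  inL2 D g /\
  forall u, test_function D u ->
    \int[leb2 R]_(p in D) (f p * partial i u p) =
    - \int[leb2 R]_(p in D) (g p * u p).

Definition inH1 D f : Prop :=
  inL2 D f /\ forall i, exists g, is_weak_partial D i f g.

(* The weak derivative is unique up to a.e. equality on D, so the choice made
   by xget is irrelevant; the default value is taken only outside H^1(D). *)
Definition weak_partial D i f : R * R -> R :=
  xget (cst 0) [set g | is_weak_partial D i f g].

Definition H1norm D f : R :=
  Num.sqrt (L2norm D f ^+ 2 + L2norm D (weak_partial D true f) ^+ 2 +
            L2norm D (weak_partial D false f) ^+ 2).

End Sobolev.

Section Data.
Context {R : realType}.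
Local Open Scope complex_scope.

Definition cos_basis (n : nat) (y : R) : R :=
  if n is 0%N then 1 else Num.sqrt 2 * cos (n%:R * pi * y).

Definition mode (h : R * R -> R) (n : nat) (x : R) : R :=
  \int[lebesgue_measure]_(y in `]0, 1[) (h (x, y) * cos_basis n y).

Definition cintegral (f : R -> R[i]) : R[i] :=
  (\int[lebesgue_measure]_z complex.Re (f z)) +i* (\int[lebesgue_measure]_z complex.Im (f z)).

Definition expi (t : R) : R[i] := cos t +i* sin t.

Definition Gamma (f : R -> R) (omega : R) : R[i] :=
  (0 +i* 1) / (2 * omega)%:C * cintegral (fun z => (f z)%:C * expi (omega * z)).

(* The restriction _ \_ _ extends the n-th mode on ]-r, r[ by 0. *)
Definition data (r : R) (h : R * R -> R) (n : nat) : R -> R[i] :=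
  Gamma (mode h n \_ `]- r, r[%classic).

Definition band (kmax : R) (n : nat) : set R :=
  `]n%:R * pi, kmax + Num.sqrt (kmax ^+ 2 - n%:R ^+ 2 * pi ^+ 2)[%classic.

(* `|z| has type R[i] for z : R[i]; its real part is the modulus as an element
   of R. *)
Definition data_norm (N : nat) (kmax : R) (d : nat -> R -> R[i]) : R :=
  Num.sqrt (\sum_(0 <= n < N.+1)
    \int[lebesgue_measure]_(w in band kmax n)
      (w ^+ 2 * complex.Re `|d n w| ^+ 2)).

End Data.

(* Main.v *)
Require Import Defs.
From HB Require Import structures.
From mathcomp Require Import all_boot all_order all_algebra complex.
From mathcomp Require Import all_classical all_reals all_analysis.
From mathcomp Require Import measurable_realfun ring lra.

(** The constant xi may depend on kmax, N, r, M and eps, and the third term of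
    the bound, c0 = 8 pi (N+1) M^2 / kmax^2, is a fixed positive number. Write
    u = h - happ. It therefore suffices to find d0 > 0, independent of h and
    happ, such that a data distance at most d0 forces
      |u|^2 <= c0 + 4 M^2 / (N pi)^2   ([small_band_L2_le]);
    when the distance exceeds d0, the trivial bound |u|^2 <= 4 M^2 is absorbed
    by xi = 4 M^2 / d0^(2 - 2 eps).

    To bound u when the data are small, expand it in the products of cosines of
    the rectangle, which form a complete orthogonal family
    ([cos2_parseval_le]). Integration by parts against a sine, which vanishes at
    both ends of the interval, turns the coefficient of u of vertical index n,
    multiplied by n pi, into a coefficient of its weak vertical derivative
    ([weak_partial_sin_r]); Bessel's inequality then bounds the modes above N by
    4 M^2 / (N pi)^2. In the same way the horizontal derivative
    ([weak_partial_sin_l]) makes the modes of large horizontal frequency cost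
    less than c0 / 4. Finitely many coefficients remain ([low_modes_le]), and
    each of them tends to 0 with the data uniformly in u
    ([pairing_cos_small]).

    The last point is unique continuation for the Fourier transform of a
    compactly supported function, in a qualitative form. Up to the factor
    i / (2 w), the datum of index n at frequency w is the integral of
    u(x, y) phi_n(y) exp(i w x). Call g small if the pairing of u with
    g(x) phi_n(y) tends to 0 with the data, uniformly over the u of bounded
    norm. The small functions form a vector space closed under uniform limits.
    It contains the trigonometric functions with frequency in the band, since
    the data are Lipschitz in w with a constant depending on the norm of u
    alone. Difference quotients in the frequency put x^j cos(w x + th) in it,
    Taylor's formula moves the frequency by a fixed amount, and iteration
    reaches every real frequency ([small_cos]), in particular those of the
    horizontal cosines. *)

Set Implicit Arguments.
Unset Strict Implicit.
Unset Printing Implicit Defensive.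
Import Order.TTheory GRing.Theory Num.Theory.
Import numFieldNormedType.Exports.

Local Open Scope classical_set_scope.
Local Open Scope ring_scope.

(** * Square integrable functions on a set of finite measure *)

Section L2toolkit.
Context d (T : measurableType d) (R : realType).
Variables (mu : {measure set T -> \bar R}) (D : set T).
Hypotheses (mD : measurable D) (finD : (mu D < +oo)%E).
Implicit Types f g : T -> R.

Definition sqint f : Prop :=
  measurable_fun D f /\ mu.-integrable D (EFin \o (fun x => f x ^+ 2)).

Definition ip f g : R := \int[mu]_(x in D) (f x * g x).

Lemma ipE f g : ip f g = \int[mu]_(x in D) (f x * g x).
Proof. by []. Qed.

Lemma dominated_integrableR f g : measurable_fun D f ->
  mu.-integrable D (EFin \o g) -> (forall x, D x -> `|f x| <= g x) ->
  mu.-integrable D (EFin \o f).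
Proof.
move=> mf ig fg; apply: (le_integrable mD _ _ ig).
  exact/measurable_EFinP.
by move=> x Dx /=; rewrite lee_fin (le_trans (fg _ Dx))// ler_norm.
Qed.

Lemma integrable_bounded f C : measurable_fun D f ->
  (forall x, D x -> `|f x| <= C) -> mu.-integrable D (EFin \o f).
Proof.
move=> mf fC; apply: measurable_bounded_integrable => //.
exists C; split; first exact: num_real.
by move=> M CM x /= Dx; exact: le_trans (fC _ Dx) (ltW CM).
Qed.

Lemma sqint_bounded f C : measurable_fun D f ->
  (forall x, D x -> `|f x| <= C) -> sqint f.
Proof.
move=> mf fC; split => //; apply: (@integrable_bounded _ (C ^+ 2)).
  exact: measurable_funX.
by move=> x Dx /=; rewrite normrX lerXn2r ?nnegrE// ?fC// (le_trans _ (fC _ Dx)).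
Qed.

Lemma sqint_mul f g : sqint f -> sqint g ->
  mu.-integrable D (EFin \o (fun x => f x * g x)).
Proof.
move=> [mf f2] [mg g2].
apply: (@dominated_integrableR _ (fun x => f x ^+ 2 + g x ^+ 2)).
- exact: measurable_funM.
- exact: (integrableD mD f2 g2).
- by move=> x _; rewrite ler_norml; apply/andP; split; nra.
Qed.

Lemma sqintZ a f : sqint f -> sqint (fun x => a * f x).
Proof.
move=> [mf f2]; split; first exact: measurable_funM.
rewrite [X in _.-integrable _ X](_ : _ = (fun x => (a ^+ 2)%:E * (f x ^+ 2)%:E)%E).
  exact: integrableZl.
by apply/funext => x /=; rewrite -EFinM exprMn.
Qed.

Lemma sqintD f g : sqint f -> sqint g -> sqint (fun x => f x + g x).
Proof.
move=> sf sg; split; first by apply: measurable_funD; [case: sf|case: sg].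
have -> : EFin \o (fun x => (f x + g x) ^+ 2) =
  ((EFin \o (fun x => f x ^+ 2)%R) \+ (EFin \o (fun x => f x * (2 * g x))%R) \+
   (EFin \o (fun x => g x ^+ 2)%R))%E.
  by apply/funext => x /=; rewrite -!EFinD; congr EFin; ring.
apply: integrableD => //; last by case: sg.
apply: integrableD => //; first by case: sf.
by apply: sqint_mul => //; exact: sqintZ.
Qed.

Lemma sqintB f g : sqint f -> sqint g -> sqint (fun x => f x - g x).
Proof.
move=> sf sg; rewrite (_ : (fun x => _) = fun x => f x + (-1) * g x).
  by apply: sqintD => //; exact: sqintZ.
by apply/funext => x; rewrite mulN1r.
Qed.

Lemma sqint_cst c : sqint (fun=> c).
Proof. exact: (@sqint_bounded _ `|c|). Qed.

Lemma sqint_integrable f : sqint f -> mu.-integrable D (EFin \o f).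
Proof.
move=> sf; rewrite [X in EFin \o X](_ : f = fun x => f x * (fun=> 1) x).
  by apply: sqint_mul => //; exact: sqint_cst.
by apply/funext => x; rewrite mulr1.
Qed.

Lemma ipC f g : ip f g = ip g f.
Proof. by rewrite /ip; under eq_Rintegral do rewrite mulrC. Qed.

Lemma eq_ip f f' g g' : (forall x, D x -> f x = f' x) ->
  (forall x, D x -> g x = g' x) -> ip f g = ip f' g'.
Proof.
by move=> ff gg; apply: eq_Rintegral => x /set_mem Dx; rewrite ff// gg.
Qed.

Lemma ip_ge0 f : 0 <= ip f f.
Proof. by apply: Rintegral_ge0 => x _; rewrite -expr2 sqr_ge0. Qed.

Lemma ip0l g : ip (fun=> 0) g = 0.
Proof.
rewrite /ip; under eq_Rintegral do rewrite mul0r.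
by rewrite Rintegral_cst// mul0r.
Qed.

Lemma ipDl f g h : sqint f -> sqint g -> sqint h ->
  ip (fun x => f x + g x) h = ip f h + ip g h.
Proof.
move=> sf sg sh; rewrite /ip -RintegralD//; [|exact: sqint_mul..].
by apply: eq_Rintegral => x _; rewrite mulrDl.
Qed.

Lemma ipZl a f h : sqint f -> sqint h -> ip (fun x => a * f x) h = a * ip f h.
Proof.
move=> sf sh; rewrite /ip -RintegralZl//; last exact: sqint_mul.
by apply: eq_Rintegral => x _; rewrite mulrA.
Qed.

Lemma ipBl f g h : sqint f -> sqint g -> sqint h ->
  ip (fun x => f x - g x) h = ip f h - ip g h.
Proof.
move=> sf sg sh; rewrite /ip -RintegralB//; [|exact: sqint_mul..].
by apply: eq_Rintegral => x _; rewrite mulrBl.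
Qed.

Lemma ip_sqrB f g : sqint f -> sqint g ->
  ip (fun x => f x - g x) (fun x => f x - g x) = ip f f - 2 * ip f g + ip g g.
Proof.
move=> sf sg; have sB := sqintB sf sg.
rewrite ipBl// ![ip _ (fun x => _ - _)]ipC !ipBl// (ipC g f); ring.
Qed.

Lemma ip_sqrD_le f g : sqint f -> sqint g ->
  ip (fun x => f x + g x) (fun x => f x + g x) <= 2 * ip f f + 2 * ip g g.
Proof.
move=> sf sg; have sD := sqintD sf sg.
have := ip_ge0 (fun x => f x - g x); rewrite ip_sqrB//.
rewrite ipDl// ![ip _ (fun x => _ + _)]ipC !ipDl// (ipC g f); lra.
Qed.

Lemma ip_sqrB_le f g : sqint f -> sqint g ->
  ip (fun x => f x - g x) (fun x => f x - g x) <= 2 * ip f f + 2 * ip g g.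
Proof.
move=> sf sg; have sD := sqintD sf sg.
have := ip_ge0 (fun x => f x + g x); rewrite ip_sqrB//.
rewrite ipDl// ![ip _ (fun x => _ + _)]ipC !ipDl// (ipC g f); lra.
Qed.

Lemma Rdominated_cvg (f_ : (T -> R)^nat) f g :
  (forall n, measurable_fun D (f_ n)) ->
  (forall x, D x -> f_ ^~ x @ \oo --> f x) ->
  mu.-integrable D (EFin \o g) ->
  (forall n x, D x -> `|f_ n x| <= g x) ->
  measurable_fun D f /\
  \int[mu]_(x in D) f_ n x @[n --> \oo] --> \int[mu]_(x in D) f x.
Proof.
move=> mf_ f_f ig f_g.
have mf : measurable_fun D f by apply: measurable_fun_cvg mf_ _.
split => //.
have [||||fi _ cv] := @dominated_convergence _ _ _ mu D mD
  (fun n => EFin \o f_ n) (EFin \o f) (EFin \o g) _ _ _ ig.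
- by move=> n; exact/measurable_EFinP.
- exact/measurable_EFinP.
- by apply/aeW => x Dx /=; apply/fine_cvgP; split;
    [exact: nearW|exact: f_f].
- by apply/aeW => x n Dx /=; rewrite lee_fin f_g.
have fin : (\int[mu]_(x in D) (EFin \o f) x)%E \is a fin_num.
  exact: integrable_fin_num.
by apply: (@fine_cvg _ _ _ _ (fun n => (\int[mu]_(x in D) (f_ n x)%:E)%E));
  rewrite fineK.
Qed.

End L2toolkit.

(** * Orthogonal families and approximation *)

Section OrthogonalFamily.
Context d (T : measurableType d) (R : realType).
Variables (mu : {measure set T -> \bar R}) (D : set T).
Hypotheses (mD : measurable D) (finD : (mu D < +oo)%E).
Implicit Types f g : T -> R.
Variables (I : eqType) (e : I -> T -> R) (nu : I -> R).
Hypothesis sqe : forall i, sqint mu D (e i).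
Local Notation sqint := (sqint mu D).
Local Notation ip := (ip mu D).

(** Finite combinations are generated one term at a time, so that linear
    closure is proved by induction; [lspan_sum] recovers a sum over distinct
    indices, the form required by orthogonality. *)
Inductive lspan : (T -> R) -> Prop :=
| lspan0 : lspan (fun=> 0)
| lspanS c i f : lspan f -> lspan (fun x => c * e i x + f x).

Lemma lspanD f g : lspan f -> lspan g -> lspan (fun x => f x + g x).
Proof.
move=> sf sg; elim: sf => [|c i h _ ih].
  by under eq_fun do rewrite add0r.
by under eq_fun do rewrite -addrA; exact: lspanS.
Qed.

Lemma lspanZ a f : lspan f -> lspan (fun x => a * f x).
Proof.
elim=> [|c i h _ ih]; first by under eq_fun do rewrite mulr0; exact: lspan0.
by under eq_fun do rewrite mulrDr mulrA; exact: lspanS.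
Qed.

Lemma lspan_basis i : lspan (e i).
Proof.
rewrite (_ : e i = fun x => 1 * e i x + 0); first exact: lspanS lspan0.
by apply/funext => x; rewrite mul1r addr0.
Qed.

Lemma lspan_sqint f : lspan f -> sqint f.
Proof.
elim=> [|c i h _ ih]; first exact: sqint_cst.
by apply: sqintD => //; exact: sqintZ.
Qed.

Lemma lspan_sum f : lspan f -> exists (s : seq I) (a : I -> R),
  uniq s /\ f = fun x => \sum_(i <- s) a i * e i x.
Proof.
elim=> [|c i h _ [s [a [us ->]]]].
  by exists [::], (fun=> 0); split=> //; apply/funext => x; rewrite big_nil.
have [si|si] := boolP (i \in s).
  exists s, (fun j => if j == i then c + a j else a j); split=> //.
  apply/funext => x; rewrite !(bigD1_seq i)//= eqxx mulrDl addrA; congr (_ + _).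
  by apply: eq_bigr => j /negbTE ->.
exists (i :: s), (fun j => if j == i then c else a j); split=> /=.
  by rewrite si.
apply/funext => x; rewrite big_cons eqxx; congr (_ + _).
rewrite !big_seq; apply: eq_bigr => j js.
by have [ji|//] := eqVneq j i; rewrite -ji js in si.
Qed.

Lemma sum_lspan (s : seq I) (a : I -> R) :
  lspan (fun x => \sum_(i <- s) a i * e i x).
Proof.
elim: s => [|i s ih]; first by under eq_fun do rewrite big_nil; exact: lspan0.
by under eq_fun do rewrite big_cons; exact: lspanS.
Qed.

Section Orthogonal.
Hypothesis nu0 : forall i, 0 < nu i.
Hypothesis orth : forall i j, ip (e i) (e j) = if i == j then nu i else 0.

Lemma ip_sum_notin f (s : seq I) (a : I -> R) i : sqint f -> i \notin s ->
  ip (fun x => f x - \sum_(j <- s) a j * e j x) (e i) = ip f (e i).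
Proof.
move=> sf; elim: s => [|j s ih].
  by move=> _; apply: eq_ip => // x _; rewrite big_nil subr0.
rewrite inE negb_or => /andP[ij si]; rewrite -(ih si).
have sg : sqint (fun x => f x - \sum_(k <- s) a k * e k x).
  by apply: sqintB => //; apply: lspan_sqint; exact: sum_lspan.
have ji0 : a j * ip (e j) (e i) = 0 by rewrite orth eq_sym (negbTE ij) mulr0.
rewrite -[RHS]subr0 -[X in _ = _ - X]ji0 -ipZl// -ipBl//; last exact: sqintZ.
by apply: eq_ip => // x _; rewrite big_cons; ring.
Qed.

(** Expansion of the squared distance from [f] to a combination of orthogonal
    functions; both Bessel's inequality and the optimality of the Fourier
    coefficients are read off from it. *)
Lemma dist_sum f (s : seq I) (a : I -> R) : sqint f -> uniq s ->
  let g := fun x => f x - \sum_(i <- s) a i * e i x in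
  ip g g = ip f f - \sum_(i <- s) (2 * a i * ip f (e i) - a i ^+ 2 * nu i).
Proof.
move=> sf; elim: s => [|i s ih] /=.
  by move=> _; rewrite big_nil subr0; apply: eq_ip => x _; rewrite big_nil subr0.
move=> /andP[si us]; rewrite big_cons.
set g := fun x => f x - \sum_(k <- s) a k * e k x.
have sg : sqint g.
  by apply: sqintB => //; apply: lspan_sqint; exact: sum_lspan.
have -> : (fun x => f x - \sum_(j <- i :: s) a j * e j x) =
          fun x => g x - a i * e i x.
  by apply/funext => x; rewrite big_cons /g; ring.
have sai : sqint (fun x => a i * e i x) by exact: sqintZ.
rewrite ip_sqrB// ih// ![ip _ (fun=> _ * _)]ipC !ipZl//.
by rewrite [ip (e i) g]ipC /g ip_sum_notin// [ip (e i) (fun=> _ * _)]ipC ipZl// orth eqxx; ring.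
Qed.

Lemma bessel f (s : seq I) : sqint f -> uniq s ->
  \sum_(i <- s) ip f (e i) ^+ 2 / nu i <= ip f f.
Proof.
move=> sf us; have := dist_sum (fun i => ip f (e i) / nu i) sf us.
set g := fun x => _ => /= gE; have := ip_ge0 mu D g.
rewrite gE subr_ge0; apply: le_trans; rewrite le_eqVlt; apply/orP; left.
apply/eqP; apply: eq_bigr => i _; field; exact: lt0r_neq0.
Qed.

(** Fourier coefficients minimize the distance, hence any approximant in the
    span bounds the defect in Parseval's identity from above. *)
Lemma dist_sum_ge f (s : seq I) (a : I -> R) : sqint f -> uniq s ->
  let g := fun x => f x - \sum_(i <- s) a i * e i x in
  ip f f <= \sum_(i <- s) ip f (e i) ^+ 2 / nu i + ip g g.
Proof.
move=> sf us /=; rewrite dist_sum// addrC -addrA lerDl addrC subr_ge0.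
apply: ler_sum => i _; rewrite ler_pdivlMr// -subr_ge0.
rewrite [leRHS](_ : _ = (ip f (e i) - a i * nu i) ^+ 2); last by ring.
exact: sqr_ge0.
Qed.

End Orthogonal.

Definition approximable f := forall eps : R, 0 < eps ->
  exists2 P, lspan P & ip (fun x => f x - P x) (fun x => f x - P x) <= eps.

Lemma approximable_lspan f : lspan f -> approximable f.
Proof.
move=> sf eps e0; exists f => //; rewrite (@eq_ip _ _ _ _ _ _ (fun=> 0) _ (fun=> 0)).
- by rewrite ip0l// ltW.
- by move=> x _; rewrite subrr.
- by move=> x _; rewrite subrr.
Qed.

Lemma approximableZ a f : sqint f -> approximable f ->
  approximable (fun x => a * f x).
Proof.
move=> sf af eps e0.
have a0 : 0 < a ^+ 2 + 1 by rewrite ltr_wpDl// sqr_ge0.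
have [|P sP fP] := af (eps / (a ^+ 2 + 1)); first by rewrite divr_gt0.
exists (fun x => a * P x); first exact: lspanZ.
have sB : sqint (fun x => f x - P x) by apply: sqintB => //; exact: lspan_sqint.
rewrite (_ : (fun x => _) = fun x => a * (f x - P x)); last first.
  by apply/funext => x; rewrite mulrBr.
rewrite ipZl//; last exact: sqintZ.
rewrite ipC ipZl// mulrA -expr2.
move: fP; rewrite ler_pdivlMr//; apply: le_trans; rewrite mulrC ler_wpM2l//.
  exact: ip_ge0.
by rewrite lerDl.
Qed.

Lemma approximableD f g : sqint f -> sqint g ->
  approximable f -> approximable g -> approximable (fun x => f x + g x).
Proof.
move=> sf sg af ag eps e0; have e4 : 0 < eps / 4 by rewrite divr_gt0.
have [P sP fP] := af _ e4; have [Q sQ gQ] := ag _ e4.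
exists (fun x => P x + Q x); first exact: lspanD.
rewrite (_ : (fun x => _) = fun x => (f x - P x) + (g x - Q x)); last first.
  by apply/funext => x; rewrite opprD addrACA.
have sfP : sqint (fun x => f x - P x) by apply: sqintB => //; exact: lspan_sqint.
have sgQ : sqint (fun x => g x - Q x) by apply: sqintB => //; exact: lspan_sqint.
by have := ip_sqrD_le mD sfP sgQ; lra.
Qed.

Lemma approximableB f g : sqint f -> sqint g ->
  approximable f -> approximable g -> approximable (fun x => f x - g x).
Proof.
move=> sf sg af ag; rewrite (_ : (fun x => _) = fun x => f x + (-1) * g x).
  by apply: approximableD => //; [exact: sqintZ|exact: approximableZ].
by apply/funext => x; rewrite mulN1r.
Qed.

(** Dominated convergence turns bounded pointwise limits into approximable
    functions; completeness rests on this lemma. *)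
Lemma approximable_lim (f_ : (T -> R)^nat) f h :
  (forall n, measurable_fun D (f_ n)) -> sqint h ->
  (forall x, D x -> f_ ^~ x @ \oo --> f x) ->
  (forall n x, D x -> `|f_ n x| <= h x) ->
  (forall n, approximable (f_ n)) -> sqint f /\ approximable f.
Proof.
move=> mf_ sh f_f f_h af_.
have sf_ n : sqint (f_ n).
  split=> //; apply: (dominated_integrableR mD _ (proj2 sh)) => //.
    exact: measurable_funX.
  move=> x Dx /=; rewrite normrX lerXn2r ?nnegrE//.
    exact: le_trans (f_h n x Dx).
  exact: f_h.
have f_h' x : D x -> `|f x| <= h x.
  move=> Dx; have cv : `|f_ n x| @[n --> \oo] --> `|f x|.
    by apply: cvg_norm; exact: f_f.
  rewrite -(cvg_lim (@norm_hausdorff _ R) cv); apply: limr_le.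
    by apply/cvg_ex; exists `|f x|.
  by apply: nearW => n; exact: f_h.
have mf : measurable_fun D f by apply: measurable_fun_cvg mf_ _.
have sf : sqint f.
  split=> //; apply: (dominated_integrableR mD _ (proj2 sh)) => //.
    exact: measurable_funX.
  move=> x Dx /=; rewrite normrX lerXn2r ?nnegrE//.
    exact: le_trans (f_h' x Dx).
  exact: f_h'.
split=> // eps e0.
have [||||_] := @Rdominated_cvg _ _ _ mu D mD
  (fun n x => (f x - f_ n x) ^+ 2) (fun=> 0) (fun x => 4 * h x ^+ 2).
- by move=> n; apply: measurable_funX; exact: measurable_funB.
- move=> x Dx; rewrite -[0](_ : (f x - f x) ^+ 2 = 0); last by rewrite subrr expr0n.
  rewrite expr2; under eq_fun do rewrite expr2.
  by apply: cvgM; apply: cvgB => //; [exact: cvg_cst|exact: f_f|exact: cvg_cst|exact: f_f].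
- rewrite [X in _.-integrable _ X](_ : _ = (fun x => 4%:E * (h x ^+ 2)%:E)%E).
    by apply: integrableZl => //; case: sh.
  by apply/funext => x /=; rewrite EFinM.
- move=> n x Dx; rewrite ger0_norm ?sqr_ge0//.
  have := f_h n x Dx; have := f_h' x Dx.
  by rewrite !ler_norml => /andP[? ?] /andP[? ?]; nra.
rewrite Rintegral_cst// mul0r => /cvgrPdist_lt /(_ (eps / 4)).
have e4 : 0 < eps / 4 by rewrite divr_gt0.
move=> /(_ e4)[n _ /(_ n (leqnn n))] /=; rewrite sub0r normrN => Hn.
have [P sP nP] := af_ n _ e4; exists P => //.
rewrite (_ : (fun x => _) = fun x => (f x - f_ n x) + (f_ n x - P x)); last first.
  by apply/funext => x; ring.
have sfn : sqint (fun x => f x - f_ n x) by exact: sqintB.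
have snP : sqint (fun x => f_ n x - P x).
  by apply: sqintB => //; exact: lspan_sqint.
have := ip_sqrD_le mD sfn snP.
have : ip (fun x => f x - f_ n x) (fun x => f x - f_ n x) <= eps / 4.
  rewrite (le_trans (ler_norm _))// ltW//.
lra.
Qed.

End OrthogonalFamily.

(** * Density criteria *)

Import HBSimple HBNNSimple.

Section Density.
Context d (T : measurableType d) (R : realType).
Variables (mu : {measure set T -> \bar R}) (D : set T).
Hypotheses (mD : measurable D) (finD : (mu D < +oo)%E).
Implicit Types f g : T -> R.
Variables (Idx : eqType) (e : Idx -> T -> R).
Hypothesis sqe : forall i, sqint mu D (e i).
Local Notation sqint := (sqint mu D).
Local Notation approximable := (approximable mu D e).

Lemma sqint_indic A : measurable A -> sqint (\1_A).
Proof.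
move=> mA; apply: (@sqint_bounded _ _ _ _ _ mD finD _ 1) => [|x _].
  exact: measurable_indic.
by rewrite indicE ger0_norm// lern1 leq_b1.
Qed.

Lemma approximable_sum (J : Type) (s : seq J) (F : J -> T -> R) :
  (forall j, sqint (F j)) -> (forall j, approximable (F j)) ->
  sqint (fun x => \sum_(j <- s) F j x) /\
  approximable (fun x => \sum_(j <- s) F j x).
Proof.
move=> sF aF; elim: s => [|j s [ih1 ih2]].
  under eq_fun do rewrite big_nil.
  split; first exact: sqint_cst.
  by apply: approximable_lspan => //; exact: lspan0.
under eq_fun do rewrite big_cons; split; first exact: sqintD.
exact: approximableD.
Qed.

(** Stability under disjoint unions, the closure property specific to Dynkin
    systems. *)
Lemma approximable_bigcup (F : (set T)^nat) :
  (forall n, measurable (F n)) -> trivIset setT F ->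
  (forall n, approximable \1_(F n)) -> approximable \1_(\bigcup_n F n).
Proof.
move=> mF tF aF.
pose u n x : R := \sum_(i <- iota 0 n) \1_(F i) x.
have u01 n x : u n x = \1_(\bigcup_(i < n) F i) x.
  rewrite /u; elim: n => [|n ih]; first by rewrite big_nil bigcup_mkord big_ord0 indic0.
  rewrite -addn1 iotaD big_cat/= big_seq1 ih add0n addn1 !indicE.
  have [xn|xn] := boolP (x \in F n).
    have -> : x \in \bigcup_(i < n.+1) F i by apply/mem_set; exists n => //=; exact/set_mem.
    rewrite memNset ?add0r// => -[k /= kn Fkx]; have := tF k n I I.
    have /[swap]/[apply] : (F k `&` F n) !=set0 by exists x; split=> //; exact/set_mem.
    by move=> kE; move: kn; rewrite kE ltnn.
  rewrite addr0; congr (nat_of_bool _)%:R; apply/idP/idP.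
    move=> /set_mem[k /= kn Fkx]; apply/mem_set; exists k => //=.
    exact: ltnW.
  move=> /set_mem[k /=]; rewrite ltnS leq_eqVlt => /predU1P[->|kn] Fkx.
    by rewrite mem_set in xn.
  by apply/mem_set; exists k.
apply: (proj2 (@approximable_lim _ _ _ mu D mD finD _ e sqe u _ (fun=> 1) _ _ _ _ _)).
- by move=> n; apply: measurable_sum => i; exact: measurable_indic.
- exact: sqint_cst.
- move=> x _; apply: cvg_near_cst.
  have [[k _ Fkx]|nF] := pselect ((\bigcup_n F n) x).
    exists k.+1 => // n /= kn; apply/eqP; rewrite u01 !indicE !mem_set//.
      by exists k.
    by exists k.
  apply: nearW => n; apply/eqP; rewrite u01 !indicE !memNset// => -[k _ Fkx].
  by apply: nF; exists k.
- by move=> n x _; rewrite u01 indicE ger0_norm// lern1 leq_b1.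
- by move=> n; apply: (proj2 (approximable_sum _ _ _)) => // j; exact: sqint_indic.
Qed.

Lemma approximable_setC A B : measurable A -> measurable B -> A `<=` B ->
  approximable \1_A -> approximable \1_B -> approximable \1_(B `\` A).
Proof.
move=> mA mB AB aA aB.
have -> : \1_(B `\` A) = fun x => \1_B x - \1_A x :> R.
  apply/funext => x; rewrite !indicE in_setD.
  have [xA|xA] := boolP (x \in A); last by rewrite andbT subr0.
  by rewrite andbF mem_set ?subrr//; apply: AB; exact: set_mem.
by apply: approximableB => //; exact: sqint_indic.
Qed.

(** Simple functions increase to f, which dominates them. *)
Lemma approximable_nneg f : (forall A, measurable A -> approximable \1_A) ->
  (forall x, 0 <= f x) -> sqint f -> approximable f.
Proof.
move=> aI f0 sf; have [mf _] := sf.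
have mEf : measurable_fun D (EFin \o f) by exact/measurable_EFinP.
pose u := nnsfun_approx mD mEf.
have u_f x : D x -> u ^~ x @ \oo --> f x.
  move=> Dx; have := @cvg_nnsfun_approx _ _ _ _ mD _ mEf _ _ Dx.
  by move=> /(_ (fun x _ => f0 x))/fine_cvgP[].
apply: (proj2 (@approximable_lim _ _ _ mu D mD finD _ e sqe
  (fun n => u n : T -> R) f f _ sf u_f _ _)).
- by move=> n; apply: measurable_funTS.
- move=> n x Dx; rewrite ger0_norm ?fun_ge0//.
  rewrite -(cvg_lim (@norm_hausdorff _ R) (u_f x Dx)).
  apply: nondecreasing_cvgn_le; last by apply/cvg_ex; exists (f x); exact: u_f.
  by move=> m k mk; have /lefP := @nd_nnsfun_approx _ _ _ _ mD _ mEf m k mk; apply.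
move=> n; rewrite (_ : (u n : T -> R) = fun x => \sum_(y <- finmap.enum_fset (fset_set (range (u n))))
    (fun x => y * \1_(u n @^-1` [set y]) x) x); last first.
  by apply/funext => x; rewrite fimfunE fsbig_finite.
have sI y : sqint (\1_(u n @^-1` [set y])) by exact: sqint_indic.
have mpre y : measurable (u n @^-1` [set y]) by [].
apply: (proj2 (approximable_sum _ _ _)) => y; first exact: sqintZ.
by apply: approximableZ => //; exact: aI.
Qed.

(** Positive and negative parts are limits of simple functions. *)
Lemma approximable_sqint f : (forall A, measurable A -> approximable \1_A) ->
  sqint f -> approximable f.
Proof.
move=> aI sf; have [mf f2] := sf.
have sqle g : measurable_fun D g -> (forall x, D x -> `|g x| <= `|f x|) -> sqint g.
  move=> mg gf; split => //; apply: (dominated_integrableR mD _ f2).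
    exact: measurable_funX.
  move=> x Dx; rewrite normrX -[leRHS]ger0_norm ?sqr_ge0// normrX.
  by rewrite lerXn2r ?nnegrE// gf.
have sp : sqint f^\+.
  apply: sqle; first exact: measurable_funrpos.
  by move=> x _; rewrite ger0_norm ?funrpos_ge0// /funrpos ge_max ler_norm normr_ge0.
have sn : sqint f^\-.
  apply: sqle; first exact: measurable_funrneg.
  by move=> x _; rewrite ger0_norm ?funrneg_ge0// /funrneg ge_max -normrN ler_norm normr_ge0.
rewrite -(funrposBneg f); apply: approximableB => //; apply: approximable_nneg => //.
Qed.

End Density.

Section DensityProduct.
Context d1 d2 (T1 : measurableType d1) (T2 : measurableType d2) (R : realType).
Variables (mu : {measure set (T1 * T2) -> \bar R}) (D : set (T1 * T2)).
Hypotheses (mD : measurable D) (finD : (mu D < +oo)%E).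
Variables (Idx : eqType) (e : Idx -> T1 * T2 -> R).
Hypothesis sqe : forall i, sqint mu D (e i).
Local Notation approximable := (approximable mu D e).
Variables (G1 : set (set T1)) (G2 : set (set T2)).
Hypotheses (G1E : @measurable _ T1 = <<s G1 >>) (G2E : @measurable _ T2 = <<s G2 >>).
Hypotheses (G1I : setI_closed G1) (G2I : setI_closed G2).
Hypothesis base : forall A B, (A = setT \/ G1 A) -> (B = setT \/ G2 B) ->
  approximable \1_(A `*` B).

Let mG2 B : B = setT \/ G2 B -> measurable B.
Proof. by case=> [->//|GB]; rewrite G2E; exact: sub_sigma_algebra. Qed.

Let approximable_rect1 A B : measurable A -> (B = setT \/ G2 B) ->
  approximable \1_(A `*` B).
Proof.
move=> mA GB; have mB := mG2 GB; rewrite G1E in mA.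
pose P := fun S : set T1 => approximable \1_(S `*` B).
apply: (@dynkin_induction _ _ G1 P) (mA) => //.
- by apply: base => //; left.
- by move=> S GS; apply: base => //; right.
- move=> S mS PS; rewrite /P.
  have -> : ~` S `*` B = (setT `*` B) `\` (S `*` B).
    rewrite predeqE => -[x y]; split=> /=; first by move=> [? ?]; split=> // -[].
    by move=> [[_ ?] h]; split=> // ?; apply: h.
  apply: approximable_setC => //; [exact: measurableX|exact: measurableX| |].
    exact: setSX.
  by apply: base => //; left.
- move=> F mF tF PF; rewrite /P setX_bigcupl.
  apply: approximable_bigcup => //; first by move=> n; exact: measurableX.
  by apply/trivIsetP => i j _ _ ij; rewrite -setXI;
     move/trivIsetP : tF => /(_ i j I I ij) ->; rewrite set0X.
Qed.

Let approximable_rect A B : measurable A -> measurable B ->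
  approximable \1_(A `*` B).
Proof.
move=> mA mB; rewrite G2E in mB.
pose P := fun S : set T2 => approximable \1_(A `*` S).
apply: (@dynkin_induction _ _ G2 P) (mB) => //.
- by apply: approximable_rect1 => //; left.
- by move=> S GS; apply: approximable_rect1 => //; right.
- move=> S mS PS; rewrite /P.
  have -> : A `*` ~` S = (A `*` setT) `\` (A `*` S).
    rewrite predeqE => -[x y]; split=> /=; first by move=> [? ?]; split=> // -[].
    by move=> [[? _] h]; split=> // ?; apply: h.
  apply: approximable_setC => //; [exact: measurableX|exact: measurableX| |].
    by move=> [x y] [? _].
  by apply: approximable_rect1 => //; left.
- move=> F mF tF PF; rewrite /P setX_bigcupr.
  apply: approximable_bigcup => //; first by move=> n; exact: measurableX.
  by apply/trivIsetP => i j _ _ ij; rewrite -setXI;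
     move/trivIsetP : tF => /(_ i j I I ij) ->; rewrite setX0.
Qed.

(** Dynkin's lemma, once for each factor and once for the product. *)
Lemma approximable_prod f : sqint mu D f -> approximable f.
Proof.
apply: approximable_sqint => // A; rewrite measurable_prod_measurableType => mA.
apply: (@dynkin_induction _ (T1 * T2)%type
  [set A `*` B | A in measurable & B in measurable] (fun S => approximable \1_S)) mA => //.
- exact: measurable_prod_measurableType.
- move=> _ _ [A1 mA1 [B1 mB1 <-]] [A2 mA2 [B2 mB2 <-]]; exists (A1 `&` A2).
    exact: measurableI.
  by exists (B1 `&` B2); [exact: measurableI|rewrite setXI].
- by rewrite -setXTT; apply: approximable_rect.
- by move=> _ [A1 mA1 [B1 mB1 <-]]; exact: approximable_rect.
- move=> S mS PS; rewrite -setTD; apply: approximable_setC => //.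
  by rewrite -setXTT; apply: approximable_rect.
- by move=> F mF tF PF; exact: approximable_bigcup.
Qed.

End DensityProduct.

(** * The cosine and sine systems of an interval *)

Section AffineDerivative.
Context {R : realType}.
Implicit Types f : R -> R.

Lemma is_derive_affine (c d x : R) : is_derive x 1 (fun t : R => c * t + d) c.
Proof.
have := @is_deriveD R R R (fun t => c *: t) (cst d) x 1 (c *: 1) 0
  (@is_deriveZ R R R id c x 1 1 (is_derive_id x 1)) (is_derive_cst d x 1).
by rewrite addr0 /GRing.scale/= mulr1.
Qed.

Lemma is_derive_comp_affine f (c d x df : R) : is_derive (c * x + d) 1 f df ->
  is_derive x 1 (fun t => f (c * t + d)) (c * df).
Proof.
move=> fdf; rewrite mulrC.
exact: (@is_derive1_comp R f (fun t => c * t + d) x df c fdf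
  (is_derive_affine c d x)).
Qed.

Lemma continuous_affine (c d : R) : continuous (fun t : R => c * t + d).
Proof.
by move=> x; apply: cvgD; [apply: cvgM; [exact: cvg_cst|exact: cvg_id]|exact: cvg_cst].
Qed.

End AffineDerivative.

Section CosineBasis.
Context {R : realType}.
Variables (a b : R).
Hypothesis ab : a < b.
Local Notation leb := (@lebesgue_measure R).
Local Notation D := (`]a, b[%classic : set (measurableTypeR R)).

Definition freq (a b : R) (m : nat) : R := m%:R * (pi / (b - a)).
Definition cosn (a b : R) (m : nat) (x : R) : R := cos (freq a b m * (x - a)).
Definition sinn (a b : R) (m : nat) (x : R) : R := sin (freq a b m * (x - a)).

Let ba0 : 0 < b - a. Proof. by rewrite subr_gt0. Qed.

Lemma cosnE m : cosn a b m = fun x => cos (freq a b m * x + - freq a b m * a).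
Proof. by apply/funext => x; rewrite /cosn mulrBr mulNr. Qed.

Lemma sinnE m : sinn a b m = fun x => sin (freq a b m * x + - freq a b m * a).
Proof. by apply/funext => x; rewrite /sinn mulrBr mulNr. Qed.

Lemma is_derive_cosn (m : nat) (x : R) :
  is_derive x 1 (cosn a b m) (- (freq a b m * sinn a b m x)).
Proof.
rewrite cosnE sinnE /=.
have := is_derive_comp_affine (is_derive_cos (freq a b m * x + - freq a b m * a)).
by rewrite mulrN.
Qed.

Lemma is_derive_sinn (m : nat) (x : R) :
  is_derive x 1 (sinn a b m) (freq a b m * cosn a b m x).
Proof.
rewrite cosnE sinnE /=; exact: is_derive_comp_affine.
Qed.

Lemma continuous_cosn m : continuous (cosn a b m).
Proof.
move=> x; apply: differentiable_continuous; apply/derivable1_diffP.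
by have [] := is_derive_cosn m x.
Qed.

Lemma continuous_sinn m : continuous (sinn a b m).
Proof.
move=> x; apply: differentiable_continuous; apply/derivable1_diffP.
by have [] := is_derive_sinn m x.
Qed.

Lemma sin_natpi (m : nat) : sin (m%:R * pi : R) = 0.
Proof.
elim: m => [|m ih]; first by rewrite mul0r sin0.
by rewrite -natr1 mulrDl mul1r sinD ih sinpi mul0r mulr0 addr0.
Qed.

Lemma freq_end m : freq a b m * (b - a) = m%:R * pi.
Proof. by rewrite /freq -mulrA divfK// lt0r_neq0. Qed.

Lemma sinn_end m : sinn a b m b = 0.
Proof. by rewrite /sinn freq_end sin_natpi. Qed.

Lemma sinn_start m : sinn a b m a = 0.
Proof. by rewrite /sinn subrr mulr0 sin0. Qed.

Lemma leb_itv_fin : (leb D < +oo)%E.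
Proof. by rewrite lebesgue_measure_itv/=; case: ifPn => // _; rewrite -EFinB ltry. Qed.

Lemma fine_leb_itv : fine (leb D) = b - a.
Proof. by rewrite lebesgue_measure_itv/= lte_fin ab. Qed.

Lemma continuous_sqint (f : R -> R) C : continuous f -> (forall x, `|f x| <= C) ->
  sqint leb D f.
Proof.
move=> cf fC; apply: (@sqint_bounded _ _ _ leb D _ leb_itv_fin _ C) => //.
by apply: measurable_funTS; exact: continuous_measurable_fun.
Qed.

Lemma sqint_cosn m : sqint leb D (cosn a b m).
Proof.
apply: (@continuous_sqint _ 1); [exact: continuous_cosn|by move=> x; exact: cos_max].
Qed.

Lemma sqint_sinn m : sqint leb D (sinn a b m).
Proof.
apply: (@continuous_sqint _ 1); [exact: continuous_sinn|by move=> x; exact: sin_max].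
Qed.

Lemma integral_cosn m :
  \int[leb]_(x in D) cosn a b m x = if m == 0%N then b - a else 0.
Proof.
have [->|m0] := eqVneq m 0%N.
  under eq_Rintegral do rewrite /cosn /freq !mul0r cos0.
  by rewrite Rintegral_cst// mul1r; exact: fine_leb_itv.
have f0 : freq a b m != 0.
  by rewrite /freq mulf_neq0 ?pnatr_eq0// mulf_neq0 ?invr_eq0 ?lt0r_neq0// pi_gt0.
have icos : leb.-integrable `[a, b] (EFin \o cosn a b m).
  apply: continuous_compact_integrable; first exact: segment_compact.
  exact/continuous_subspaceT/continuous_cosn.
rewrite Rintegral_itv_obnd_cbnd; last first.
  by apply: integrableS icos => //; exact: subset_itv_oo_cc.
rewrite Rintegral_itv_bndo_bndc; last first.
  by apply: integrableS icos => //; exact: subset_itv_co_cc.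
have dF (x : R) : is_derive x 1 (fun x => (freq a b m)^-1 * sinn a b m x) (cosn a b m x).
  have := @is_deriveZ R R R (sinn a b m) (freq a b m)^-1 x 1 _ (is_derive_sinn m x).
  by rewrite /GRing.scale/= mulKf.
rewrite /Rintegral.
rewrite (@continuous_FTC2 _ _ (fun x => (freq a b m)^-1 * sinn a b m x))//.
- by rewrite sinn_end sinn_start mulr0 -EFinB subrr.
- exact/continuous_subspaceT/continuous_cosn.
- split.
  + by move=> x _; have [] := dF x.
  + apply: cvg_at_right_filter; apply: cvgM; first exact: cvg_cst.
    exact: continuous_sinn.
  + apply: cvg_at_left_filter; apply: cvgM; first exact: cvg_cst.
    exact: continuous_sinn.
- by move=> x _; rewrite derive1E; have [_ ->] := dF x.
Qed.

Let cosM_half (x y : R) : cos x * cos y = (cos (x + y) + cos (x - y)) / 2.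
Proof. by rewrite cosB cosD; field. Qed.

Let sinM_half (x y : R) : sin x * sin y = (cos (x - y) - cos (x + y)) / 2.
Proof. by rewrite cosB cosD; field. Qed.

Let cosn_half m n x : (n <= m)%N ->
  cos (freq a b m * (x - a) - freq a b n * (x - a)) = cosn a b (m - n) x.
Proof. by move=> nm; rewrite -mulrBl /cosn /freq natrB// [in RHS](mulrBl (pi / (b - a))). Qed.

Let cosn_halfD m n x :
  cos (freq a b m * (x - a) + freq a b n * (x - a)) = cosn a b (m + n) x.
Proof. by rewrite -mulrDl /cosn /freq natrD [in RHS](mulrDl _ _ (pi / (b - a))). Qed.

Lemma cosnM m n x : (n <= m)%N ->
  cosn a b m x * cosn a b n x = (cosn a b (m + n) x + cosn a b (m - n) x) / 2.
Proof.
by move=> nm; rewrite -cosn_half// -cosn_halfD; exact: cosM_half.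
Qed.

Lemma sinnM m n x : (n <= m)%N ->
  sinn a b m x * sinn a b n x = (cosn a b (m - n) x - cosn a b (m + n) x) / 2.
Proof.
by move=> nm; rewrite -cosn_half// -cosn_halfD; exact: sinM_half.
Qed.

Lemma ip_cosn m n : ip leb D (cosn a b m) (cosn a b n) =
  if m == n then (if m == 0%N then b - a else (b - a) / 2) else 0.
Proof.
wlog nm : m n / (n <= m)%N.
  move=> h; have [/h//|/ltnW nm] := leqP n m.
  by rewrite ipC h// eq_sym; case: eqP => // ->.
have int k : leb.-integrable D (EFin \o cosn a b k).
  exact: (sqint_integrable _ leb_itv_fin (sqint_cosn k)).
rewrite /ip; under eq_Rintegral do rewrite (cosnM _ nm) mulrC.
rewrite RintegralZl//; last exact: (integrableD _ (int _) (int _)).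
rewrite RintegralD// !integral_cosn subn_eq0 addn_eq0 [m == n]eqn_leq nm andbT.
have [mn|mn] /= := leqP m n; last first.
  by rewrite (gtn_eqF (leq_ltn_trans (leq0n n) mn)) addr0 mulr0.
have -> : n = m by apply/eqP; rewrite eqn_leq nm.
by rewrite andbb; case: eqP => _; field.
Qed.

Lemma ip_sinn m n : ip leb D (sinn a b m.+1) (sinn a b n.+1) =
  if m == n then (b - a) / 2 else 0.
Proof.
wlog nm : m n / (n <= m)%N.
  move=> h; have [/h//|/ltnW nm] := leqP n m.
  by rewrite ipC h// eq_sym.
have int k : leb.-integrable D (EFin \o cosn a b k).
  exact: (sqint_integrable _ leb_itv_fin (sqint_cosn k)).
rewrite /ip; under eq_Rintegral do rewrite sinnM 1?mulrC//.
rewrite RintegralZl//; last exact: (integrableB _ (int _) (int _)).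
rewrite RintegralB// !integral_cosn subn_eq0 ltnS addn_eq0/= [m == n]eqn_leq nm andbT.
by rewrite subr0; case: ifP => _; rewrite ?mulr0// mulrC.
Qed.

End CosineBasis.

(** * Fubini's theorem and polynomial steps *)

Section RealFubini.
Context d1 d2 (T1 : measurableType d1) (T2 : measurableType d2) (R : realType).
Variables (m1 : {sigma_finite_measure set T1 -> \bar R}).
Variables (m2 : {sigma_finite_measure set T2 -> \bar R}).

(** The inner integral is finite only almost everywhere; where it is not, its
    real-valued version is 0, which does not affect the outer one. *)
Lemma Rfubini (D1 : set T1) (D2 : set T2) (f : T1 * T2 -> R) :
  measurable D1 -> measurable D2 ->
  (m1 \x m2)%E.-integrable (D1 `*` D2) (EFin \o f) ->
  \int[(m1 \x m2)%E]_(p in D1 `*` D2) f p =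
  \int[m1]_(x in D1) \int[m2]_(y in D2) f (x, y).
Proof.
move=> mD1 mD2 intf.
pose F := (EFin \o f) \_ (D1 `*` D2).
have iF : (m1 \x m2)%E.-integrable setT F.
  by rewrite -integrable_mkcond//; exact: measurableX.
rewrite [LHS]/Rintegral integral_mkcond -/F -(integral12_prod_meas1 iF).
rewrite [RHS]/Rintegral integral_mkcond; congr fine.
have FE x : fubini_F m2 F x =
    if x \in D1 then (\int[m2]_(y in D2) (f (x, y))%:E)%E else 0%E.
  rewrite /fubini_F /F; case: ifPn => xD1.
    rewrite [RHS]integral_mkcond; apply: eq_integral => y _.
    by rewrite /patch in_setX xD1.
  rewrite integral0_eq// => y _.
  by rewrite /patch in_setX (negbTE xD1).
have mFF := measurable_fubini_F iF.
rewrite (_ : (fun x => _) \_ D1 = EFin \o (fine \o fubini_F m2 F)); last first.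
  apply/funext => x; rewrite /patch /= FE; case: ifPn => // xD1.
apply: ae_eq_integral => //.
  by apply/measurable_EFinP; exact: measurableT_comp.
apply: filterS (ae_integrable1 iF) => x iFx _ /=.
by rewrite fineK//; exact: integrable_fin_num.
Qed.

End RealFubini.

Section StepPolynomials.
Context {R : realType}.
Implicit Types (t x : R) (n k : nat).

(** These polynomials tend to 1 on the interval from 0 to 1/2, end included,
    and to 0 beyond 1/2. With t^n and the power 2^n the value at 1/2 itself
    would tend to 1/e; the extra factor t^n repairs this. *)
Definition step_poly n t : R := (1 - t ^+ (n ^ 2 + n)) ^+ (2 ^ (n ^ 2)).

Lemma bernoulli_le k x : 0 <= x <= 1 -> 1 - k%:R * x <= (1 - x) ^+ k.
Proof.
move=> /andP[x0 x1]; elim: k => [|k ih]; first by rewrite mul0r subr0 expr0.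
rewrite exprS -natr1.
have k0 : 0 <= k%:R :> R by [].
have := ler_wpM2l (_ : 0 <= 1 - x) ih; rewrite subr_ge0 => /(_ x1).
by apply: le_trans; nra.
Qed.

Lemma bernoulli_inv_le k x : 0 <= x <= 1 -> (1 - x) ^+ k * (1 + k%:R * x) <= 1.
Proof.
move=> /andP[x0 x1]; elim: k => [|k ih]; first by rewrite mul0r addr0 expr0 mulr1.
apply: le_trans ih; rewrite exprSr -mulrA ler_wpM2l ?exprn_ge0 ?subr_ge0//.
rewrite -natr1; have k0 : 0 <= k%:R :> R by [].
by nra.
Qed.

Lemma step_poly01 n t : 0 <= t <= 1 -> 0 <= step_poly n t <= 1.
Proof.
move=> /andP[t0 t1]; have tn := exprn_ge0 (n ^ 2 + n) t0.
have tn1 : t ^+ (n ^ 2 + n) <= 1 by rewrite exprn_ile1.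
rewrite /step_poly exprn_ge0 ?subr_ge0//= exprn_ile1 ?subr_ge0//.
by rewrite gerBl.
Qed.

Lemma step_poly_cvg1 t : 0 <= t <= 2^-1 -> step_poly n t @[n --> \oo] --> (1 : R).
Proof.
move=> /andP[t0 t2].
have t1 : t <= 1 by rewrite (le_trans t2)// invf_le1// ler1n.
apply: (@squeeze_cvgr _ _ _ _ (fun n => 1 - 2^-1 ^+ n) (fun=> 1)).
- apply: nearW => n; apply/andP; split; last first.
    by have /andP[] := @step_poly01 n t (introT andP (conj t0 t1)).
  apply: le_trans (bernoulli_le _ _); last first.
    by rewrite exprn_ge0//= exprn_ile1.
  rewrite lerD2l lerN2.
  have : t ^+ (n ^ 2 + n) <= 2^-1 ^+ (n ^ 2 + n) by rewrite lerXn2r ?nnegrE.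
  move=> /(ler_wpM2l (ler0n R (2 ^ n ^ 2))) /le_trans; apply.
  by rewrite exprD mulrA natrX -exprMn divff ?expr1n ?mul1r.
- rewrite -[X in _ --> X]subr0; apply: cvgB; first exact: cvg_cst.
  by apply: cvg_expr; rewrite ger0_norm ?invf_lt1 ?ltr1n.
- exact: cvg_cst.
Qed.

(** By the reverse Bernoulli inequality it is enough that 2^(n^2) t^(n^2 + n),
    that is, ((2 t)^n t)^n, tend to infinity. *)
Lemma step_poly_cvg0 t : 2^-1 < t <= 1 -> step_poly n t @[n --> \oo] --> (0 : R).
Proof.
move=> /andP[t2 t1]; have t0 : 0 < t by rewrite (lt_trans _ t2).
apply: (@squeeze_cvgr _ _ _ _ (fun=> 0) (fun n => (n.+1)%:R^-1)); last 2 first.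
- exact: cvg_cst.
- exact: cvg_harmonic.
have q1 : 0 < 2 * t - 1 by lra.
near=> n; apply/andP; split.
  by have /andP[] := @step_poly01 n t (introT andP (conj (ltW t0) t1)).
rewrite -[leRHS]mul1r ler_pdivlMr//.
apply: le_trans (bernoulli_inv_le (2 ^ n ^ 2) (_ : 0 <= t ^+ (n ^ 2 + n) <= 1)); last first.
  by rewrite exprn_ge0 ?exprn_ile1// ltW.
have /andP[s0 _] := @step_poly01 n t (introT andP (conj (ltW t0) t1)).
rewrite ler_wpM2l// -natr1 addrC lerD2l.
have -> : (2 ^ n ^ 2)%:R * t ^+ (n ^ 2 + n) = ((2 * t) ^+ n * t) ^+ n.
  by rewrite natrX exprMn -exprM mulnn exprD mulrA -exprMn.
apply: (@le_trans _ _ (2 ^+ n)); first by rewrite -natrX ler_nat ltnW// ltn_expl.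
rewrite lerXn2r ?nnegrE ?mulr_ge0 ?exprn_ge0 ?mulr_ge0 ?(ltW t0)//.
apply: (@le_trans _ _ ((n%:R * (2 * t - 1)) * t)).
  have : 2 / ((2 * t - 1) * t) <= n%:R by near: n; exact: nbhs_infty_ger.
  by rewrite ler_pdivrMr ?mulr_gt0// mulrA.
rewrite ler_wpM2r ?(ltW t0)//.
have qn k (q : R) : 0 <= q -> k%:R * q <= (1 + q) ^+ k.
  move=> q0; elim: k => [|k ih]; first by rewrite mul0r expr0.
  rewrite exprS -natr1 !mulrDl !mul1r lerD//.
  by rewrite ler_peMr// exprn_ege1// lerDl.
have := qn n _ (ltW q1); rewrite (_ : 1 + (2 * t - 1) = 2 * t)//; ring.
Unshelve. all: by end_near.
Qed.

End StepPolynomials.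

(** * Completeness of the product cosines *)

Section CosinePolynomials.
Context {R : realType}.
Variables (a b : R).
Hypothesis ab : a < b.

Lemma lspan_cosnM f : lspan (cosn a b) f ->
  lspan (cosn a b) (fun x => f x * cosn a b 1 x).
Proof.
elim=> [|c m g _ ih]; first by under eq_fun do rewrite mul0r; exact: lspan0.
under eq_fun do rewrite mulrDl -mulrA; apply: lspanD ih; apply: lspanZ.
case: m => [|m].
  rewrite (_ : (fun x => _) = cosn a b 1); first exact: lspan_basis.
  by apply/funext => x; rewrite {1}/cosn /freq !mul0r cos0 mul1r.
rewrite (_ : (fun x => _) = fun x => 2^-1 * (cosn a b (m.+1 + 1) x + cosn a b (m.+1 - 1) x)).
  by apply: lspanZ; apply: lspanD; exact: lspan_basis.
by apply/funext => x; rewrite cosnM// mulrC.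
Qed.

Lemma lspan_cst (c : R) : lspan (cosn a b) (fun=> c).
Proof.
rewrite (_ : (fun=> c) = fun x => c * cosn a b 0 x); first exact/lspanZ/lspan_basis.
by apply/funext => x; rewrite /cosn /freq !mul0r cos0 mulr1.
Qed.

(** Products of cosines are sums of cosines, so polynomials in the first
    non-constant one stay in the span. *)
Lemma lspan_horner (p : {poly R}) :
  lspan (cosn a b) (fun x => p.[cosn a b 1 x]).
Proof.
elim/poly_ind: p => [|p c ih]; first by under eq_fun do rewrite horner0; exact: lspan0.
under eq_fun do rewrite !hornerE.
by apply: lspanD (lspan_cst c); exact: lspan_cosnM.
Qed.

Lemma cosn1_le (s x : R) : s \in `[a, b] -> x \in `[a, b] ->
  (cosn a b 1 x <= cosn a b 1 s) = (s <= x).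
Proof.
move=> sab xab; have c0 : 0 < freq a b 1.
  by rewrite /freq mul1r divr_gt0 ?subr_gt0 ?pi_gt0.
have mem z : z \in `[a, b] -> freq a b 1 * (z - a) \in `[0, pi].
  rewrite !in_itv/= => /andP[az zb]; rewrite mulr_ge0 ?subr_ge0 ?(ltW c0)//=.
  by rewrite -[leRHS]mul1r -(freq_end ab 1) ler_pM2l// lerD2r.
rewrite /cosn [LHS]leNgt ltr_cos; [|exact: mem..].
by rewrite ltr_pM2l// ltrD2r -leNgt.
Qed.

(** The indicator of a closed ray is a bounded pointwise limit of polynomials
    in the first non-constant cosine, because that cosine is decreasing. *)
Lemma ray_limit (A : set R) : A = setT \/ RGenCInfty.G A ->
  exists p : nat -> R -> R, [/\ forall k, lspan (cosn a b) (p k),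
    forall k x, x \in `]a, b[ -> 0 <= p k x <= 1 &
    forall x, x \in `]a, b[ -> p ^~ x @ \oo --> (\1_A x : R)].
Proof.
have one : (forall x, x \in `]a, b[ -> A x) -> exists p : nat -> R -> R,
    [/\ forall k, lspan (cosn a b) (p k),
    forall k x, x \in `]a, b[ -> 0 <= p k x <= 1 &
    forall x, x \in `]a, b[ -> p ^~ x @ \oo --> (\1_A x : R)].
  move=> sub; exists (fun _ _ => 1); split => [k|k x _|x xab].
  - exact: lspan_cst.
  - by rewrite ler01 lexx.
  - by rewrite indicE mem_set; [exact: cvg_cst|exact: sub].
case=> [AT|[s AE]]; first by apply: one => x _; rewrite AT.
have [sa|as_] := leP s a.
  apply: one => x; rewrite in_itv/= => /andP[ax _].
  by rewrite AE /= in_itv/= andbT (le_trans sa)// ltW.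
have [bs|sb] := leP b s.
  exists (fun _ _ => 0); split => [k|k x _|x].
  - exact: lspan_cst.
  - by rewrite ler01 lexx.
  - rewrite in_itv/= => /andP[_ xb]; rewrite indicE memNset; first exact: cvg_cst.
    by rewrite AE /= in_itv/= andbT; apply/negP; rewrite -ltNge (lt_le_trans xb).
have sab : s \in `[a, b] by rewrite in_itv/= !ltW.
pose t x : R := 2^-1 + (cosn a b 1 x - cosn a b 1 s) / 4.
have t01 x : 0 <= t x <= 1.
  have := cos_max (freq a b 1 * (x - a)); have := cos_max (freq a b 1 * (s - a)).
  rewrite !ler_norml -/(cosn a b 1 s) -/(cosn a b 1 x) /t.
  by move=> /andP[? ?] /andP[? ?]; apply/andP; split; lra.
exists (fun n x => step_poly n (t x)); split => [k|k x _|x xab].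
- rewrite (_ : (fun x => _) = fun x =>
    ((1 - ((2^-1)%:P + ('X - (cosn a b 1 s)%:P) * (4^-1)%:P) ^+ (k ^ 2 + k))
      ^+ (2 ^ (k ^ 2))).[cosn a b 1 x]); first exact: lspan_horner.
  by apply/funext => x; rewrite /step_poly /t !hornerE.
- exact: step_poly01.
have xab' : x \in `[a, b] by exact: subset_itv_oo_cc.
rewrite indicE; have [sx|xs] := leP s x.
  rewrite mem_set; last by rewrite AE /= in_itv/= sx.
  apply: step_poly_cvg1; have /andP[-> _] := t01 x.
  by rewrite /t gerDl pmulr_lle0// subr_le0 cosn1_le.
rewrite memNset; last by rewrite AE /= in_itv/= andbT; apply/negP; rewrite -ltNge.
apply: step_poly_cvg0; have /andP[_ ->] := t01 x.
by rewrite andbT /t ltrDl pmulr_lgt0// subr_gt0 ltNge cosn1_le// -ltNge.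
Qed.

End CosinePolynomials.

Section RectangleL2.
Context {R : realType}.
Variables (a1 b1 a2 b2 : R).
Hypotheses (ab1 : a1 < b1) (ab2 : a2 < b2).
Local Notation leb := (@lebesgue_measure R).
Local Notation D1 := (`]a1, b1[%classic : set (measurableTypeR R)).
Local Notation D2 := (`]a2, b2[%classic : set (measurableTypeR R)).
Local Notation D := (D1 `*` D2).

Lemma measurable_rect : measurable D.
Proof. exact: measurableX. Qed.

Lemma leb2_rect : leb2 R D = ((b1 - a1) * (b2 - a2))%:E.
Proof.
have itvE (a b : R) : a < b -> leb `]a, b[%classic = (b - a)%:E.
  by move=> ab; rewrite lebesgue_measure_itv/= lte_fin ab EFinB.
rewrite EFinM -(itvE _ _ ab1) -(itvE _ _ ab2).
exact: (product_measure1E leb leb).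
Qed.

Lemma leb2_rect_fin : (leb2 R D < +oo)%E.
Proof. by rewrite leb2_rect ltry. Qed.

Definition tensor (f g : R -> R) (p : measurableTypeR R * measurableTypeR R) : R :=
  f p.1 * g p.2.

Lemma measurable_tensor f g : continuous f -> continuous g ->
  measurable_fun D (tensor f g).
Proof.
move=> cf cg; apply: measurable_funTS; apply: measurable_funM.
  by apply: measurableT_comp; [exact: continuous_measurable_fun|exact: measurable_fst].
by apply: measurableT_comp; [exact: continuous_measurable_fun|exact: measurable_snd].
Qed.

Lemma sqint_tensor f g C : continuous f -> continuous g ->
  (forall x, `|f x| <= C) -> (forall x, `|g x| <= C) ->
  sqint (leb2 R) D (tensor f g).
Proof.
move=> cf cg fC gC; apply: (@sqint_bounded _ _ _ _ _ measurable_rect leb2_rect_fin _ (C * C)).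
  exact: measurable_tensor.
by move=> p _; rewrite /tensor normrM ler_pM.
Qed.

Lemma ip_tensor f g f' g' :
  sqint leb D1 f -> sqint leb D2 g -> sqint leb D1 f' -> sqint leb D2 g' ->
  sqint (leb2 R) D (tensor f g) -> sqint (leb2 R) D (tensor f' g') ->
  ip (leb2 R) D (tensor f g) (tensor f' g') = ip leb D1 f f' * ip leb D2 g g'.
Proof.
move=> sf sg sf' sg' s2 s2'.
rewrite {1}/ip /leb2 Rfubini//; last exact: (sqint_mul measurable_rect).
rewrite /ip -RintegralZr//; last exact: sqint_mul.
apply: eq_Rintegral => x _; rewrite -RintegralZl//; last exact: sqint_mul.
by apply: eq_Rintegral => y _; rewrite /tensor/=; ring.
Qed.

Definition cos2 (i : nat * nat) : measurableTypeR R * measurableTypeR R -> R :=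
  tensor (cosn a1 b1 i.1) (cosn a2 b2 i.2).

Definition nu2 (i : nat * nat) : R :=
  (if i.1 == 0%N then b1 - a1 else (b1 - a1) / 2) *
  (if i.2 == 0%N then b2 - a2 else (b2 - a2) / 2).

Lemma cos2E m n : cos2 (m, n) = tensor (cosn a1 b1 m) (cosn a2 b2 n).
Proof. by []. Qed.

Lemma sqint_cos2 i : sqint (leb2 R) D (cos2 i).
Proof.
by apply: (@sqint_tensor _ _ 1); [exact: continuous_cosn|exact: continuous_cosn|
  move=> x; exact: cos_max|move=> x; exact: cos_max].
Qed.

Lemma nu2_gt0 i : 0 < nu2 i.
Proof.
have h1 : 0 < b1 - a1 by rewrite subr_gt0.
have h2 : 0 < b2 - a2 by rewrite subr_gt0.
by rewrite /nu2; apply: mulr_gt0; case: ifP => _ //; rewrite divr_gt0.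
Qed.

Lemma ip_cos2 i j : ip (leb2 R) D (cos2 i) (cos2 j) = if i == j then nu2 i else 0.
Proof.
rewrite ip_tensor; [|exact: sqint_cosn..|exact: sqint_cos2|exact: sqint_cos2].
rewrite !ip_cosn//; case: i j => [i1 i2] [j1 j2] /=; rewrite xpair_eqE /nu2/=.
by have [->|_] := eqVneq i1 j1; have [->|_] := eqVneq i2 j2; rewrite /= ?mulr0 ?mul0r.
Qed.

Lemma lspan_tensor f g : lspan (cosn a1 b1) f -> lspan (cosn a2 b2) g ->
  lspan cos2 (tensor f g).
Proof.
move=> sf sg; elim: sf => [|c m f' _ ih].
  rewrite (_ : tensor _ _ = fun=> 0); first exact: lspan0.
  by apply/funext => p; rewrite /tensor mul0r.
rewrite (_ : tensor _ _ = fun p => c * tensor (cosn a1 b1 m) g p + tensor f' g p); last first.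
  by apply/funext => p; rewrite /tensor mulrDl mulrA.
apply: lspanD ih; apply: lspanZ; elim: sg => [|c' n g' _ ih].
  rewrite (_ : tensor _ _ = fun=> 0); first exact: lspan0.
  by apply/funext => p; rewrite /tensor mulr0.
rewrite (_ : tensor _ _ = fun p => c' * cos2 (m, n) p + tensor (cosn a1 b1 m) g' p).
  exact: lspanS.
by apply/funext => p; rewrite /cos2 /tensor/=; ring.
Qed.

(** Products of closed rays generate the Borel sets of the plane, and their
    indicators are limits of products of polynomials in cosines. *)
Lemma cos2_complete f : sqint (leb2 R) D f -> approximable (leb2 R) D cos2 f.
Proof.
have mR : @measurable _ (measurableTypeR R) = <<s @RGenCInfty.G R >>.
  exact: RGenCInfty.measurableE.
have GI : setI_closed (@RGenCInfty.G R).
  move=> _ _ [x ->] [y ->]; exists (Num.max x y); rewrite predeqE => z /=.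
  by rewrite !in_itv/= !andbT ge_max; split => [[-> ->]|/andP[]].
apply: (approximable_prod measurable_rect leb2_rect_fin sqint_cos2 mR mR GI GI) => A B.
move=> /(ray_limit ab1)[p [sp p01 pA]] /(ray_limit ab2)[q [sq q01 qB]].
have cts a b g : lspan (cosn a b) g -> continuous g.
  elim=> [|c m h _ ih] x; first exact: cvg_cst.
  apply: cvgD; last exact: ih.
  by apply: cvgM; [exact: cvg_cst|exact: continuous_cosn].
have bnd k l x y : x \in `]a1, b1[ -> y \in `]a2, b2[ -> `|tensor (p k) (q l) (x, y)| <= 1.
  move=> xab yab; have /andP[p0 p1] := p01 k x xab; have /andP[q0 q1] := q01 l y yab.
  by rewrite /tensor/= normrM !ger0_norm// mulr_ile1.
apply: (proj2 (@approximable_lim _ _ _ (leb2 R) D measurable_rect leb2_rect_fin _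
  cos2 sqint_cos2 (fun n => tensor (p n) (q n)) _ (fun=> 1) _ _ _ _ _)).
- by move=> n; apply: measurable_tensor; exact: cts.
- exact: sqint_cst measurable_rect leb2_rect_fin _.
- move=> [x y] [/= xab yab]; rewrite /tensor/=.
  rewrite (_ : \1_(A `*` B) (x, y) = \1_A x * \1_B y).
    by apply: cvgM; [exact: pA|exact: qB].
  by rewrite !indicE in_setX -natrM mulnb.
- by move=> n [x y] [/= xab yab]; exact: bnd.
- by move=> n; apply: (approximable_lspan (leb2 R) measurable_rect); exact: lspan_tensor.
Qed.

Lemma cos2_parseval_le f (eps : R) : sqint (leb2 R) D f -> 0 < eps ->
  exists2 s : seq (nat * nat), uniq s &
    ip (leb2 R) D f f <= \sum_(i <- s) ip (leb2 R) D f (cos2 i) ^+ 2 / nu2 i + eps.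
Proof.
move=> sf e0; have [P sP fP] := cos2_complete sf e0.
have [s [c [us PE]]] := lspan_sum sP; exists s => //.
apply: (le_trans (dist_sum_ge measurable_rect leb2_rect_fin sqint_cos2 nu2_gt0 ip_cos2 c sf us)).
by rewrite lerD2l; rewrite PE in fP.
Qed.

End RectangleL2.

(** * Flat functions *)

Section FlatFunctions.
Context {R : realType}.
Implicit Types (t x : R) (j : nat).

(** The functions t^-j exp(-1/t), extended by 0: the whole family is needed
    because differentiation raises the index. *)
Definition flat j t : R := if 0 < t then t^-1 ^+ j * expR (- t^-1) else 0.

Lemma flat_le0 j t : t <= 0 -> flat j t = 0.
Proof. by rewrite /flat leNgt => /negbTE ->. Qed.

Lemma flat_ge0 j t : 0 <= flat j t.
Proof.
rewrite /flat; case: ifPn => // t0.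
by rewrite mulr_ge0 ?expR_ge0// exprn_ge0// invr_ge0 ltW.
Qed.

Lemma is_derive_of_cvg (V : normedModType R) (f : V -> R) (a v : V) (l : R) :
  h^-1 *: ((f \o shift a) (h *: v) - f a) @[h --> 0^'] --> l -> is_derive a v f l.
Proof.
move=> cv; apply: DeriveDef; first by apply/cvg_ex; exists l.
exact: (cvg_lim (@norm_hausdorff _ R)).
Qed.

Lemma expRN_bound n x : 0 <= x -> x ^+ n * expR (- x) <= n`!%:R.
Proof.
move=> x0; rewrite expRN ler_pdivrMr ?expR_gt0//.
case: n => [|n].
  by rewrite expr0 fact0 mul1r (le_trans _ (expR_ge1Dx x))// lerDl.
have n0 : 0 < (n.+1)`!%:R :> R by rewrite ltr0n fact_gt0.
have := expR_ge1Dxn n x0.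
rewrite -(ler_pM2l n0); apply: le_trans.
rewrite mulrDr mulr1 mulrCA divff ?lt0r_neq0// mulr1 lerDr; exact: ltW.
Qed.

(** Gives the derivative 0 at the origin. *)
Lemma flat_sqr_bound j t : flat j t <= (j.+2)`!%:R * t ^+ 2.
Proof.
rewrite /flat; case: ifPn => t0; last by rewrite mulr_ge0// sqr_ge0.
have := expRN_bound j.+2 (_ : 0 <= t^-1); rewrite invr_ge0 => /(_ (ltW t0)).
rewrite -(ler_pM2r (_ : 0 < t ^+ 2)) ?exprn_gt0//; apply: le_trans.
rewrite le_eqVlt; apply/orP; left; apply/eqP.
rewrite (_ : t^-1 ^+ j.+2 = t^-1 ^+ j * (t ^+ 2)^-1).
  by field; rewrite lt0r_neq0.
by rewrite -addn2 exprD -exprVn.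
Qed.

Lemma is_derive_flat j t :
  is_derive t 1 (flat j) (- j%:R * flat j.+1 t + flat j.+2 t).
Proof.
have [t0|t0|t0] := ltgtP t 0.
- rewrite !flat_le0 ?(ltW t0)// mulr0 addr0.
  apply: (@near_eq_is_derive _ _ _ (cst 0)).
  near=> z; rewrite flat_le0//; apply: ltW.
  by near: z; exact: lt_nbhsl.
- pose g := fun x : R => x ^+ j * expR (- x).
  have dg (x : R) : is_derive x 1 g (j%:R * x ^+ j.-1 * expR (- x) - x ^+ j * expR (- x)).
    have dX := @is_deriveX R R id j x 1 1 (is_derive_id x 1).
    have dE := @is_derive1_comp R expR -%R x _ _ (is_derive_expR (- x)) (is_deriveNid x 1).
    have := @is_deriveM R R _ _ x 1 _ _ dX dE.
    have -> : id ^+ j * (expR \o -%R) = g by apply/funext => y; rewrite /g !fctE.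
    rewrite /GRing.scale/= => /is_derive_eq; apply.
    by rewrite fctE; ring.
  have dV : is_derive t 1 (fun x => x^-1) (- (t ^- 2)).
    have := @is_deriveV R id t 1 1 (lt0r_neq0 t0) (is_derive_id t 1).
    by rewrite /GRing.scale/= mulr1.
  have dG : is_derive t 1 (g \o (fun x => x^-1))
      (- j%:R * flat j.+1 t + flat j.+2 t).
    have := @is_derive1_comp R g (fun x => x^-1) t _ _ (dg _) dV.
    move=> /is_derive_eq; apply; rewrite /flat t0.
    by rewrite -exprVn; case: j {g dg} => [|j] /=; rewrite !exprS; ring.
  apply: (near_eq_is_derive _ dG); near=> z; rewrite /g /flat /=.
  case: ifPn => //; rewrite -leNgt => z0; suff : 0 < z by rewrite ltNge z0.
  by near: z; exact: lt_nbhsr.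
- rewrite t0 !flat_le0// mulr0 addr0; apply: is_derive_of_cvg.
  apply/cvgr0Pnorm_le => e e0; near=> h.
  rewrite /= addr0 (flat_le0 _ (lexx 0)) subr0 /GRing.scale/= mulr1.
  have h0 : h != 0 by near: h; exact: nbhs_dnbhs_neq.
  rewrite normrM normfV ler_pdivrMl ?normr_gt0// ger0_norm ?flat_ge0//.
  apply: le_trans (flat_sqr_bound _ _) _.
  have n0 : 0 < (j.+2)`!%:R :> R by rewrite ltr0n fact_gt0.
  have : `|h| <= e / (j.+2)`!%:R by near: h; apply: dnbhs0_le; rewrite divr_gt0.
  rewrite ler_pdivlMr// -[h ^+ 2]ger0_norm ?sqr_ge0// normrX => hn.
  by rewrite expr2 mulrCA ler_wpM2l// mulrC.
Unshelve. all: by end_near.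
Qed.

End FlatFunctions.

(** * Smooth products as test functions *)

Section SmoothTensors.
Context {R : realType}.
Implicit Types (f g : R -> R).

(** A set of functions stable under differentiation, which contains every
    factor of the test functions below; stability yields all iterated partial
    derivatives of a product at once. *)
Inductive smooth1 : (R -> R) -> Prop :=
| smooth1_cst c : smooth1 (fun=> c)
| smooth1_flat j c d : smooth1 (fun x => flat j (c * x + d))
| smooth1_cosn a b m : smooth1 (cosn a b m)
| smooth1_sinn a b m : smooth1 (sinn a b m)
| smooth1_add f g : smooth1 f -> smooth1 g -> smooth1 (fun x => f x + g x)
| smooth1_mul f g : smooth1 f -> smooth1 g -> smooth1 (fun x => f x * g x).

Lemma smooth1_derive f : smooth1 f ->
  exists2 f', smooth1 f' & forall x : R, is_derive x 1 f (f' x).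
Proof.
elim=> [c|j c d|a b m|a b m|{}f g sf [f' sf' df] sg [g' sg' dg]|
  {}f g sf [f' sf' df] sg [g' sg' dg]].
- exists (fun=> 0); first exact: smooth1_cst.
  by move=> x; exact: is_derive_cst.
- exists (fun x => c * ((- j%:R) * flat j.+1 (c * x + d) + flat j.+2 (c * x + d))).
    by apply: smooth1_mul (smooth1_cst _) _; apply: smooth1_add (smooth1_flat _ _ _);
      apply: smooth1_mul (smooth1_cst _) (smooth1_flat _ _ _).
  by move=> x; apply: is_derive_comp_affine; exact: is_derive_flat.
- exists (fun x => (- freq a b m) * sinn a b m x).
    exact: smooth1_mul (smooth1_cst _) (smooth1_sinn _ _ _).
  by move=> x; rewrite mulNr; exact: is_derive_cosn.
- exists (fun x => freq a b m * cosn a b m x).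
    exact: smooth1_mul (smooth1_cst _) (smooth1_cosn _ _ _).
  by move=> x; exact: is_derive_sinn.
- exists (fun x => f' x + g' x); first exact: smooth1_add.
  by move=> x; exact: (@is_deriveD R R R f g x 1).
- exists (fun x => f x * g' x + g x * f' x).
    by apply: smooth1_add; exact: smooth1_mul.
  by move=> x; exact: (@is_deriveM R R f g x 1).
Qed.

Lemma is_derive_continuous f f' : (forall x : R, is_derive x 1 f (f' x)) ->
  continuous f.
Proof.
move=> df x; apply: differentiable_continuous; apply/derivable1_diffP.
by have [] := df x.
Qed.

Lemma smooth1_continuous f : smooth1 f -> continuous f.
Proof. by move=> /smooth1_derive[f' _ df]; exact: is_derive_continuous df. Qed.

Lemma is_derive_tensorl f g f' (p : R * R) : (forall x : R, is_derive x 1 f (f' x)) ->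
  is_derive p (Defs.basis true : R * R) (tensor f g : R * R -> R) (tensor f' g p).
Proof.
move=> df; apply: is_derive_of_cvg; case: p => x y.
have [/cvg_ex[l cl] dl] := df x.
have lE : l = f' x.
  by rewrite -dl; apply/esym; exact: (cvg_lim (@norm_hausdorff _ R) cl).
rewrite /tensor /= -lE; apply: cvg_trans (cvgM cl (cvg_cst (g y))).
apply: near_eq_cvg; near=> h => /=.
by rewrite /GRing.scale/= mulr0 add0r -mulrA -mulrBl.
Unshelve. all: by end_near.
Qed.

Lemma is_derive_tensorr f g g' (p : R * R) : (forall x : R, is_derive x 1 g (g' x)) ->
  is_derive p (Defs.basis false : R * R) (tensor f g : R * R -> R) (tensor f g' p).
Proof.
move=> dg; apply: is_derive_of_cvg; case: p => x y.
have [/cvg_ex[l cl] dl] := dg y.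
have lE : l = g' y.
  by rewrite -dl; apply/esym; exact: (cvg_lim (@norm_hausdorff _ R) cl).
rewrite /tensor /= -lE; apply: cvg_trans (cvgM (cvg_cst (f x)) cl).
apply: near_eq_cvg; near=> h => /=.
by rewrite /GRing.scale/= mulr0 add0r mulrCA -mulrBr.
Unshelve. all: by end_near.
Qed.

Lemma partial_tensorl f g f' : (forall x : R, is_derive x 1 f (f' x)) ->
  partial true (tensor f g) = tensor f' g.
Proof.
by move=> df; apply/funext => p; have [_ <-] := is_derive_tensorl g p df.
Qed.

Lemma partial_tensorr f g g' : (forall x : R, is_derive x 1 g (g' x)) ->
  partial false (tensor f g) = tensor f g'.
Proof.
by move=> dg; apply/funext => p; have [_ <-] := is_derive_tensorr f p dg.
Qed.

(** Each partial derivative of a product differentiates one of its factors. *)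
Lemma smooth_tensor f g : smooth1 f -> smooth1 g -> smooth (tensor f g).
Proof.
move=> sf sg s.
have [F [G [sF sG ->]]] : exists F G, [/\ smooth1 F, smooth1 G & iter_partial s (tensor f g) = tensor F G].
  elim: s => [|i s [F [G [sF sG E]]]]; first by exists f, g.
  have [F' sF' dF] := smooth1_derive sF; have [G' sG' dG] := smooth1_derive sG.
  rewrite /= E; case: i.
    by exists F', G; split => //; exact: partial_tensorl.
  by exists F, G'; split => //; exact: partial_tensorr.
split=> [p|i p].
  apply: (@cvgM R _ (nbhs p) _ (F \o fst) (G \o snd)).
    by apply: continuous_comp; [exact: cvg_fst|exact: smooth1_continuous].
  by apply: continuous_comp; [exact: cvg_snd|exact: smooth1_continuous].
have [F' sF' dF] := smooth1_derive sF; have [G' sG' dG] := smooth1_derive sG.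
by case: i; [have [] := is_derive_tensorl G p dF|have [] := is_derive_tensorr F p dG].
Qed.

Lemma test_function_tensor f g (c1 d1 c2 d2 : R) (D : set (R * R)) : smooth1 f -> smooth1 g ->
  (forall x, f x != 0 -> x \in `[c1, d1]) ->
  (forall y, g y != 0 -> y \in `[c2, d2]) ->
  `[c1, d1]%classic `*` `[c2, d2]%classic `<=` D ->
  test_function D (tensor f g).
Proof.
move=> sf sg f0 g0 sub.
have cpt : compact (`[c1, d1]%classic `*` `[c2, d2]%classic : set (R * R)).
  by apply: compact_setX; exact: segment_compact.
have supp : support_set (tensor f g) `<=` `[c1, d1]%classic `*` `[c2, d2]%classic.
  rewrite /support_set closureE; apply: smallest_sub.
    exact: compact_closed (@norm_hausdorff R (R * R)%type) cpt.
  move=> [x y] /=; rewrite /tensor /= mulf_eq0 negb_or => /andP[fx gy].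
  by split => /=; [exact: f0|exact: g0].
split; [exact: smooth_tensor| |exact: subset_trans sub].
by apply: subclosed_compact cpt supp; exact: closed_closure.
Qed.

End SmoothTensors.

(** * Cutoffs *)

Section Cutoff.
Context {R : realType}.
Implicit Types (f : R -> R) (k : nat).

Lemma flat0_le1 (t : R) : flat 0 t <= 1.
Proof.
rewrite /flat; case: ifPn => // t0; rewrite expr0 mul1r.
by rewrite -[leRHS]expR0 ler_expR oppr_le0 invr_ge0 ltW.
Qed.

Lemma flat0_ge (s : R) : 2 <= s -> 1 - 2 / s <= flat 0 (s - 1).
Proof.
move=> s2; have s0 : 0 < s by lra.
have t0 : 0 < s - 1 by lra.
rewrite /flat t0 expr0 mul1r; apply: le_trans (expR_ge1Dx _).
rewrite lerD2l lerN2 -[leLHS]mulr1 ler_pdivrMl// mulrA ler_pdivlMr//; lra.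
Qed.

(** The derivative of the cutoff at distance c from an end is, up to a
    factor at most 1, of the form k * flat 2 (k * c - 1); multiplied by a
    function of order c it becomes the left-hand side with s = k * c, which is
    bounded and tends to 0 at infinity ([flat2_le]). *)
Lemma flat2_le3 (s : R) : 0 <= s -> s * flat 2 (s - 1) <= 3.
Proof.
move=> s0; rewrite /flat; case: ifPn => t0; last by rewrite mulr0.
set x := (s - 1)^-1; have x0 : 0 < x by rewrite invr_gt0.
have -> : s = x^-1 + 1 by rewrite /x invrK subrK.
have := expR_ge1Dxn 1 (ltW x0); rewrite (_ : (2`!)%:R = 2 :> R)// => e2.
have e1 := expR_ge1Dx x.
rewrite mulrA expRN ler_pdivrMr ?expR_gt0//.
rewrite (_ : (x^-1 + 1) * x ^+ 2 = x + x ^+ 2); last by field; rewrite lt0r_neq0.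
lra.
Qed.

Lemma flat2_le (s : R) : 2 <= s -> s * flat 2 (s - 1) <= 4 / s.
Proof.
move=> s2; have s0 : 0 < s by lra.
have t0 : 0 < s - 1 by lra.
have e1 : expR (- (s - 1)^-1) <= 1.
  by rewrite -[leRHS]expR0 ler_expR oppr_le0 invr_ge0 ltW.
rewrite /flat t0 ler_pdivlMr//.
apply: (@le_trans _ _ (s * ((s - 1)^-1 ^+ 2 * 1) * s)).
  by rewrite ler_pM2r// ler_pM2l// ler_wpM2l// sqr_ge0.
rewrite mulr1 exprVn mulrAC -expr2 ler_pdivrMr ?exprn_gt0//; nra.
Qed.

Variables (a b : R).

(** A smooth cutoff of ]a, b[ supported at distance 1 / (k + 1) from the ends.
    It need not be equal to 1 anywhere: only its limit matters. *)
Definition cutoff k (x : R) : R :=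
  flat 0 (k.+1%:R * x + (- k.+1%:R * a - 1)) * flat 0 (- k.+1%:R * x + (k.+1%:R * b - 1)).

Definition dcutoff k (x : R) : R :=
  let k1 := k.+1%:R in
  flat 0 (k1 * x + (- k1 * a - 1)) * (- k1 * flat 2 (- k1 * x + (k1 * b - 1))) +
  flat 0 (- k1 * x + (k1 * b - 1)) * (k1 * flat 2 (k1 * x + (- k1 * a - 1))).

Lemma smooth1_cutoff k : smooth1 (cutoff k).
Proof. exact: smooth1_mul (smooth1_flat _ _ _) (smooth1_flat _ _ _). Qed.

Lemma is_derive_cutoff k (x : R) : is_derive x 1 (cutoff k) (dcutoff k x).
Proof.
have d0 (c d : R) : is_derive x 1 (fun t => flat 0 (c * t + d)) (c * flat 2 (c * x + d)).
  have := is_derive_comp_affine (is_derive_flat 0 (c * x + d)).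
  by rewrite oppr0 mul0r add0r.
exact: (@is_deriveM R R _ _ x 1 _ _ (d0 _ _) (d0 _ _)).
Qed.

Lemma cutoff_supp k x : cutoff k x != 0 ->
  x \in `[a + k.+1%:R^-1, b - k.+1%:R^-1].
Proof.
have k0 : 0 < k.+1%:R :> R by [].
rewrite /cutoff mulf_eq0 negb_or => /andP[fa fb].
have pos (t : R) : flat 0 t != 0 -> 0 < t by apply: contraNT; rewrite -leNgt => /flat_le0 ->.
have {}fa := pos _ fa; have {}fb := pos _ fb.
rewrite in_itv/=; apply/andP; split.
  rewrite -lerBrDl -(ler_pM2l k0) mulfV ?lt0r_neq0//; lra.
rewrite lerBrDl -lerBrDr -(ler_pM2l k0) mulfV ?lt0r_neq0//; lra.
Qed.

Lemma cutoff_ge0 k x : 0 <= cutoff k x.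
Proof. by rewrite mulr_ge0// flat_ge0. Qed.

Lemma cutoff_le1 k x : cutoff k x <= 1.
Proof. by rewrite mulr_ile1 ?flat_ge0 ?flat0_le1. Qed.

Let affL k x : k.+1%:R * x + (- k.+1%:R * a - 1) = k.+1%:R * (x - a) - 1 :> R.
Proof. by ring. Qed.

Let affR k x : - k.+1%:R * x + (k.+1%:R * b - 1) = k.+1%:R * (b - x) - 1 :> R.
Proof. by ring. Qed.

Let large (c : R) : 0 < c -> \forall k \near \oo, 2 <= k.+1%:R * c.
Proof.
move=> c0; near=> k; rewrite -ler_pdivrMr// -natr1.
suff : 2 / c <= k%:R by lra.
by near: k; exact: nbhs_infty_ger.
Unshelve. all: by end_near. Qed.

Let small (c C : R) : C / (k.+1%:R * c) @[k --> \oo] --> (0 : R).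
Proof.
have -> : (fun k => C / (k.+1%:R * c)) = (fun k => C / c * (harmonic k : R)).
  by apply/funext => k; rewrite /harmonic /= invfM mulrA mulrAC.
rewrite -(mulr0 (C / c)); apply: cvgM; [exact: cvg_cst|exact: cvg_harmonic].
Qed.

Let flat0_cvg (c : R) : 0 < c -> flat 0 (k.+1%:R * c - 1) @[k --> \oo] --> (1 : R).
Proof.
move=> c0; apply: (@squeeze_cvgr _ _ _ _ (fun k => 1 - 2 / (k.+1%:R * c)) (fun=> 1)).
- near=> k; rewrite flat0_le1 andbT; apply: flat0_ge.
  by near: k; exact: large.
- rewrite -[X in _ --> X]subr0; apply: cvgB; [exact: cvg_cst|exact: small].
- exact: cvg_cst.
Unshelve. all: by end_near. Qed.

Let flat2_cvg (c : R) : 0 < c ->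
  k.+1%:R * c * flat 2 (k.+1%:R * c - 1) @[k --> \oo] --> (0 : R).
Proof.
move=> c0.
apply: (@squeeze_cvgr _ _ _ _ (fun=> 0) (fun k => 4 / (k.+1%:R * c))); last 2 first.
- exact: cvg_cst.
- exact: small.
near=> k; apply/andP; split.
  by rewrite mulr_ge0 ?flat_ge0// mulr_ge0// ltW.
by apply: flat2_le; near: k; exact: large.
Unshelve. all: by end_near. Qed.

Lemma cutoff_cvg x : x \in `]a, b[ -> cutoff k x @[k --> \oo] --> (1 : R).
Proof.
rewrite in_itv/= => /andP[ax xb].
rewrite (_ : cutoff ^~ x = fun k => flat 0 (k.+1%:R * (x - a) - 1) *
    flat 0 (k.+1%:R * (b - x) - 1)); last first.
  by apply/funext => k; rewrite /cutoff affL affR.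
have xa0 : 0 < x - a by rewrite subr_gt0.
have bx0 : 0 < b - x by rewrite subr_gt0.
by have := cvgM (flat0_cvg xa0) (flat0_cvg bx0); rewrite mulr1; apply.
Qed.

Section Derivative.
Variables (f : R -> R) (C : R).
Hypotheses (fa : forall x, x \in `]a, b[ -> `|f x| <= C * (x - a))
           (fb : forall x, x \in `]a, b[ -> `|f x| <= C * (b - x)).

Let dcutoff_le k x : x \in `]a, b[ -> `|dcutoff k x * f x| <=
  C * (k.+1%:R * (x - a) * flat 2 (k.+1%:R * (x - a) - 1)) +
  C * (k.+1%:R * (b - x) * flat 2 (k.+1%:R * (b - x) - 1)).
Proof.
move=> xab; rewrite /dcutoff affL affR.
set A := flat 2 (_ * (x - a) - 1); set B := flat 2 (_ * (b - x) - 1).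
set A0 := flat 0 (_ * (x - a) - 1); set B0 := flat 0 (_ * (b - x) - 1).
have [A_ge0 B_ge0] : 0 <= A /\ 0 <= B by split; exact: flat_ge0.
have [A0_ge0 B0_ge0] : 0 <= A0 /\ 0 <= B0 by split; exact: flat_ge0.
have [A0_le1 B0_le1] : A0 <= 1 /\ B0 <= 1 by split; exact: flat0_le1.
have k0 : 0 <= k.+1%:R :> R by [].
have := fa xab; have := fb xab; set K := k.+1%:R; rewrite -/K in k0.
have n0 := normr_ge0 (f x).
move=> hb ha; rewrite mulrDl [leRHS]addrC.
apply: le_trans (ler_normD _ _) _; apply: lerD.
  rewrite !normrM normrN (ger0_norm B_ge0) (ger0_norm A0_ge0) (ger0_norm k0) -mulrA.
  rewrite (_ : C * _ = 1 * (K * B * (C * (b - x)))); last by ring.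
  by apply: ler_pM => //; rewrite ?mulr_ge0// ler_wpM2l// mulr_ge0.
rewrite !normrM (ger0_norm A_ge0) (ger0_norm B0_ge0) (ger0_norm k0) -mulrA.
rewrite (_ : C * _ = 1 * (K * A * (C * (x - a)))); last by ring.
by apply: ler_pM => //; rewrite ?mulr_ge0// ler_wpM2l// mulr_ge0.
Qed.

Hypothesis C0 : 0 <= C.

Lemma dcutoff_bound k x : x \in `]a, b[ -> `|dcutoff k x * f x| <= 6 * C.
Proof.
move=> xab; apply: le_trans (dcutoff_le _ xab) _.
move: xab; rewrite in_itv/= => /andP[ax xb].
have xa0 : 0 <= k.+1%:R * (x - a) by rewrite mulr_ge0// subr_ge0 ltW.
have bx0 : 0 <= k.+1%:R * (b - x) by rewrite mulr_ge0// subr_ge0 ltW.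
have h1 := flat2_le3 xa0; have h2 := flat2_le3 bx0.
have := ler_wpM2l C0 h1; have := ler_wpM2l C0 h2; lra.
Qed.

Lemma dcutoff_cvg x : x \in `]a, b[ ->
  dcutoff k x * f x @[k --> \oo] --> (0 : R).
Proof.
move=> xab; apply/norm_cvg0P.
apply: (@squeeze_cvgr _ _ _ _ (fun=> 0) (fun k =>
  C * (k.+1%:R * (x - a) * flat 2 (k.+1%:R * (x - a) - 1)) +
  C * (k.+1%:R * (b - x) * flat 2 (k.+1%:R * (b - x) - 1)))).
- by apply: nearW => k; rewrite normr_ge0 dcutoff_le.
- exact: cvg_cst.
move: xab; rewrite in_itv/= => /andP[ax xb].
have xa0 : 0 < x - a by rewrite subr_gt0.
have bx0 : 0 < b - x by rewrite subr_gt0.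
have := cvgD (cvgM (cvg_cst C) (flat2_cvg xa0)) (cvgM (cvg_cst C) (flat2_cvg bx0)).
by rewrite mulr0 addr0; apply.
Qed.

End Derivative.
End Cutoff.

(** * Weak derivatives against sines *)

Section SineBounds.
Context {R : realType}.

Lemma normr_sin_le (t : R) : `|sin t| <= `|t|.
Proof.
wlog t0 : t / 0 <= t.
  move=> h; have [/h//|/ltW t0] := leP 0 t.
  by rewrite -normrN -sinN -[leRHS]normrN h// oppr_ge0.
have [|c _ E] := @MVT_segment R sin cos 0 t t0 (fun x _ => is_derive_sin x).
  exact/continuous_subspaceT/continuous_sin.
move: E; rewrite sin0 !subr0 => ->.
by rewrite normrM ler_piMl// cos_max.
Qed.

Variables (a b : R).
Hypothesis ab : a < b.

Lemma freq_ge0 m : 0 <= freq a b m.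
Proof. by rewrite /freq mulr_ge0// divr_ge0 ?pi_ge0// subr_ge0 ltW. Qed.

Lemma sinn_le_start m x : a <= x -> `|sinn a b m x| <= freq a b m * (x - a).
Proof.
move=> ax; apply: le_trans (normr_sin_le _) _.
by rewrite ger0_norm// mulr_ge0 ?freq_ge0// subr_ge0.
Qed.

Lemma sinn_le_end m x : x <= b -> `|sinn a b m x| <= freq a b m * (b - x).
Proof.
move=> xb; rewrite /sinn.
have -> : freq a b m * (x - a) = m%:R * pi - freq a b m * (b - x).
  by rewrite -(freq_end ab m); ring.
rewrite sinB sin_natpi mul0r sub0r normrN normrM.
apply: (@le_trans _ _ (1 * `|freq a b m * (b - x)|)).
  by rewrite ler_pM ?cos_max ?normr_sin_le.
by rewrite mul1r ger0_norm// mulr_ge0 ?freq_ge0// subr_ge0.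
Qed.

End SineBounds.

Section CutOffFactors.
Context {R : realType}.
Variables (a b : R).
Hypothesis ab : a < b.
Implicit Types (f : R -> R) (k n : nat).

Definition cutf k f : R -> R := fun x => cutoff a b k x * f x.

Lemma cutf_supp k f x : cutf k f x != 0 ->
  x \in `[a + k.+1%:R^-1, b - k.+1%:R^-1].
Proof. by rewrite mulf_eq0 negb_or => /andP[/cutoff_supp]. Qed.

Lemma cutf_sub k (x : R) :
  x \in `[a + k.+1%:R^-1, b - k.+1%:R^-1] -> x \in `]a, b[.
Proof.
have k0 : 0 < (k.+1%:R : R)^-1 by rewrite invr_gt0.
rewrite !in_itv/= => /andP[h1 h2]; apply/andP; split.
  by rewrite (lt_le_trans _ h1)// ltrDl.
by rewrite (le_lt_trans h2)// gtrDl oppr_lt0.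
Qed.

Lemma cutf_bound k f x : `|f x| <= 1 -> `|cutf k f x| <= 1.
Proof.
move=> fx; rewrite normrM mulr_ile1//.
by rewrite ger0_norm ?cutoff_ge0// cutoff_le1.
Qed.

Lemma cutf_cvg f x : x \in `]a, b[ -> cutf k f x @[k --> \oo] --> f x.
Proof.
move=> xab; have := cvgM (cutoff_cvg xab) (cvg_cst (f x)).
by rewrite mul1r; apply.
Qed.

Lemma smooth1_cutf k f : smooth1 f -> smooth1 (cutf k f).
Proof. exact: smooth1_mul (smooth1_cutoff _ _ _). Qed.

Definition dcut_sinn k n (y : R) : R :=
  cutoff a b k y * (freq a b n * cosn a b n y) + dcutoff a b k y * sinn a b n y.

Lemma is_derive_cut_sinn k n (y : R) :
  is_derive y 1 (cutf k (sinn a b n)) (dcut_sinn k n y).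
Proof.
rewrite /dcut_sinn [dcutoff _ _ _ _ * _]mulrC.
exact: (@is_deriveM R R _ _ y 1 _ _ (is_derive_cutoff a b k y) (is_derive_sinn a b n y)).
Qed.

Lemma continuous_dcut_sinn k n : continuous (dcut_sinn k n).
Proof.
have [B' sB' dB'] := smooth1_derive (smooth1_cutf k (smooth1_sinn a b n)).
suff -> : dcut_sinn k n = B' by exact: smooth1_continuous.
by apply/funext => y; have [_ <-] := is_derive_cut_sinn k n y; have [_ <-] := dB' y.
Qed.

Let sinn_start_oo n z : z \in `]a, b[ -> `|sinn a b n z| <= freq a b n * (z - a).
Proof. by rewrite in_itv/= => /andP[/ltW az _]; exact: sinn_le_start. Qed.

Let sinn_end_oo n z : z \in `]a, b[ -> `|sinn a b n z| <= freq a b n * (b - z).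
Proof. by rewrite in_itv/= => /andP[_ /ltW zb]; exact: sinn_le_end. Qed.

Lemma dcut_sinn_bound k n y : y \in `]a, b[ ->
  `|dcut_sinn k n y| <= 7 * freq a b n + 1.
Proof.
move=> yab; have f0 := freq_ge0 ab n; apply: le_trans (ler_normD _ _) _.
have := dcutoff_bound (@sinn_start_oo n) (@sinn_end_oo n) f0 k yab.
have : `|cutoff a b k y * (freq a b n * cosn a b n y)| <= freq a b n.
  rewrite normrM [`|freq _ _ _ * _|]normrM (ger0_norm f0).
  rewrite (ger0_norm (cutoff_ge0 _ _ _ _)) mulrCA.
  rewrite ler_piMr// mulr_ile1 ?cutoff_ge0 ?cutoff_le1//; exact: cos_max.
lra.
Qed.

Lemma dcut_sinn_cvg n y : y \in `]a, b[ ->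
  dcut_sinn k n y @[k --> \oo] --> freq a b n * cosn a b n y.
Proof.
move=> yab.
have c1 : cutoff a b k y * (freq a b n * cosn a b n y) @[k --> \oo] -->
    1 * (freq a b n * cosn a b n y).
  by apply: cvgM; [exact: cutoff_cvg|exact: cvg_cst].
have := cvgD c1 (dcutoff_cvg (@sinn_start_oo n) (@sinn_end_oo n) yab).
by rewrite mul1r addr0; apply.
Qed.

End CutOffFactors.

Section WeakDerivative.
Context {R : realType}.
Variables (a1 b1 a2 b2 : R).
Hypotheses (ab1 : a1 < b1) (ab2 : a2 < b2).
Local Notation D1 := (`]a1, b1[%classic : set (measurableTypeR R)).
Local Notation D2 := (`]a2, b2[%classic : set (measurableTypeR R)).
Local Notation D := (D1 `*` D2).
Local Notation sqint := (sqint (leb2 R) D).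
Local Notation ip := (ip (leb2 R) D).
Local Notation T := (measurableTypeR R * measurableTypeR R)%type.
Implicit Types (u g v w : T -> R).

Let mD : measurable D := measurable_rect a1 b1 a2 b2.
Let finD : (leb2 R D < +oo)%E := leb2_rect_fin ab1 ab2.

Lemma ip_cvg u (v_ : nat -> T -> R) v C : sqint u ->
  (forall k, measurable_fun D (v_ k)) ->
  (forall k p, D p -> `|v_ k p| <= C) ->
  (forall p, D p -> v_ ^~ p @ \oo --> v p) ->
  ip u (v_ k) @[k --> \oo] --> ip u v.
Proof.
move=> su mv vC vv; have [mu _] := su.
have iu := sqint_integrable mD finD su.
have := @Rdominated_cvg _ _ _ (leb2 R) D mD (fun k p => u p * v_ k p)
  (fun p => u p * v p) (fun p => `|u p| * C).
case=> //.
- by move=> k; exact: measurable_funM.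
- by move=> p Dp; apply: cvgM; [exact: cvg_cst|exact: vv].
- rewrite (_ : EFin \o _ = (fun p => (C%:E * `|(u p)%:E|)%E)); last first.
    by apply/funext => p /=; rewrite mulrC EFinM.
  by apply: integrableZl => //; exact: integrable_abse.
- by move=> k p Dp; rewrite normrM ler_wpM2l// vC.
Qed.

(** The defining identity of weak derivatives passes to bounded limits of test
    functions and of their derivatives. *)
Lemma weak_partial_limit i u g (v_ : nat -> T -> R) v w C :
  is_weak_partial D i u g -> sqint u -> sqint g ->
  (forall k, test_function D (v_ k)) ->
  (forall k, measurable_fun D (v_ k)) ->
  (forall k, measurable_fun D (partial i (v_ k) : T -> R)) ->
  (forall k p, D p -> `|v_ k p| <= C) ->
  (forall k p, D p -> `|partial i (v_ k) p| <= C) ->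
  (forall p, D p -> v_ ^~ p @ \oo --> v p) ->
  (forall p, D p -> partial i (v_ k) p @[k --> \oo] --> w p) ->
  ip u w = - ip g v.
Proof.
move=> [_ wp] su sg tv mv mpv vC pvC vv pvw.
have c1 := ip_cvg su mpv pvC pvw.
have c2 : - ip g (v_ k) @[k --> \oo] --> - ip g v.
  by apply: cvgN; exact: ip_cvg sg mv vC vv.
have E : (fun k => ip u (partial i (v_ k))) = (fun k => - ip g (v_ k)).
  by apply/funext => k; exact: wp (tv k).
rewrite -(cvg_lim (@norm_hausdorff _ R) c1) E.
exact: (cvg_lim (@norm_hausdorff _ R) c2).
Qed.

(** Integration by parts against a product whose differentiated factor is a
    sine vanishing at both ends: cutting both factors off gives test functions,
    and the derivative of the cutoff, although unbounded, is harmless where the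
    sine is of the order of the distance to the boundary. *)
Lemma weak_partial_sin_r u g m n : is_weak_partial D false u g ->
  sqint u -> sqint g ->
  freq a2 b2 n * ip u (cos2 a1 b1 a2 b2 (m, n)) =
  - ip g (tensor (cosn a1 b1 m) (sinn a2 b2 n)).
Proof.
move=> wug su sg.
have f0 : 0 <= freq a2 b2 n by exact: freq_ge0.
have pE k : partial false (tensor (cutf a1 b1 k (cosn a1 b1 m)) (cutf a2 b2 k (sinn a2 b2 n))) =
    tensor (cutf a1 b1 k (cosn a1 b1 m)) (dcut_sinn a2 b2 k n).
  by apply: partial_tensorr; exact: is_derive_cut_sinn.
transitivity (ip u (tensor (cosn a1 b1 m) (fun y => freq a2 b2 n * cosn a2 b2 n y))).
  rewrite ipC -ipZl//; last exact: sqint_cos2.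
  by rewrite ipC; apply: eq_ip => // p _; rewrite /cos2 /tensor/=; ring.
apply: (@weak_partial_limit false u g
  (fun k => tensor (cutf a1 b1 k (cosn a1 b1 m)) (cutf a2 b2 k (sinn a2 b2 n))) _ _
  (7 * freq a2 b2 n + 1)) => //.
- move=> k; apply: test_function_tensor.
  + exact/smooth1_cutf/smooth1_cosn.
  + exact/smooth1_cutf/smooth1_sinn.
  + exact: cutf_supp.
  + exact: cutf_supp.
  + by move=> [x y] [/= /cutf_sub xab /cutf_sub yab].
- move=> k; apply: measurable_tensor; apply: smooth1_continuous; apply: smooth1_cutf.
    exact: smooth1_cosn.
  exact: smooth1_sinn.
- move=> k; rewrite pE; apply: measurable_tensor.
    by apply: smooth1_continuous; exact/smooth1_cutf/smooth1_cosn.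
  exact: continuous_dcut_sinn.
- move=> k p _; rewrite /tensor normrM.
  apply: (@le_trans _ _ 1); last by rewrite lerDr mulr_ge0.
  by rewrite mulr_ile1//; apply: cutf_bound; [exact: cos_max|exact: sin_max].
- move=> k [x y] [/= xab yab]; rewrite pE /tensor/= normrM.
  rewrite -[leRHS]mul1r; apply: ler_pM => //.
    by apply: cutf_bound; exact: cos_max.
  exact: dcut_sinn_bound.
- by move=> [x y] [/= xab yab]; apply: cvgM; exact: cutf_cvg.
- move=> [x y] [/= xab yab]; under eq_fun do rewrite pE.
  by apply: cvgM; [exact: cutf_cvg|exact: dcut_sinn_cvg].
Qed.

Lemma weak_partial_sin_l u g m n : is_weak_partial D true u g ->
  sqint u -> sqint g ->
  freq a1 b1 m * ip u (cos2 a1 b1 a2 b2 (m, n)) =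
  - ip g (tensor (sinn a1 b1 m) (cosn a2 b2 n)).
Proof.
move=> wug su sg.
have f0 : 0 <= freq a1 b1 m by exact: freq_ge0.
have pE k : partial true (tensor (cutf a1 b1 k (sinn a1 b1 m)) (cutf a2 b2 k (cosn a2 b2 n))) =
    tensor (dcut_sinn a1 b1 k m) (cutf a2 b2 k (cosn a2 b2 n)).
  by apply: partial_tensorl; exact: is_derive_cut_sinn.
transitivity (ip u (tensor (fun x => freq a1 b1 m * cosn a1 b1 m x) (cosn a2 b2 n))).
  rewrite ipC -ipZl//; last exact: sqint_cos2.
  by rewrite ipC; apply: eq_ip => // p _; rewrite /cos2 /tensor/=; ring.
apply: (@weak_partial_limit true u g
  (fun k => tensor (cutf a1 b1 k (sinn a1 b1 m)) (cutf a2 b2 k (cosn a2 b2 n))) _ _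
  (7 * freq a1 b1 m + 1)) => //.
- move=> k; apply: test_function_tensor.
  + exact/smooth1_cutf/smooth1_sinn.
  + exact/smooth1_cutf/smooth1_cosn.
  + exact: cutf_supp.
  + exact: cutf_supp.
  + by move=> [x y] [/= /cutf_sub xab /cutf_sub yab].
- move=> k; apply: measurable_tensor; apply: smooth1_continuous; apply: smooth1_cutf.
    exact: smooth1_sinn.
  exact: smooth1_cosn.
- move=> k; rewrite pE; apply: measurable_tensor.
    exact: continuous_dcut_sinn.
  by apply: smooth1_continuous; exact/smooth1_cutf/smooth1_cosn.
- move=> k p _; rewrite /tensor normrM.
  apply: (@le_trans _ _ 1); last by rewrite lerDr mulr_ge0.
  by rewrite mulr_ile1//; apply: cutf_bound; [exact: sin_max|exact: cos_max].
- move=> k [x y] [/= xab yab]; rewrite pE /tensor/= normrM.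
  rewrite -[leRHS]mulr1; apply: ler_pM => //.
    exact: dcut_sinn_bound.
  by apply: cutf_bound; exact: cos_max.
- by move=> [x y] [/= xab yab]; apply: cvgM; exact: cutf_cvg.
- move=> [x y] [/= xab yab]; under eq_fun do rewrite pE.
  by apply: cvgM; [exact: dcut_sinn_cvg|exact: cutf_cvg].
Qed.

End WeakDerivative.

(** * Functionals small on a frequency band *)

Section CosineTaylor.
Context {R : realType}.
Implicit Types (phi h : R) (K : nat).

(** Since the k-th derivative of cos is its translate by k pi / 2, the Taylor
    polynomials of all trigonometric functions have this single form. *)
Definition cos_taylor phi K h : R :=
  \sum_(k < K) (h ^+ k / k`!%:R * cos (phi + k%:R * (pi / 2))).

Lemma is_derive_cos_taylor phi K h :
  is_derive h 1 (cos_taylor phi K.+1) (cos_taylor (phi + pi / 2) K h).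
Proof.
rewrite (_ : cos_taylor phi K.+1 = (fun=> cos phi) \+
    \sum_(k < K) (fun h : R => ((k.+1)`!%:R^-1 * cos (phi + k.+1%:R * (pi / 2))) *: h ^+ k.+1)); last first.
  apply/funext => x; rewrite /cos_taylor big_ord_recl expr0 fact0 divr1 mul1r mul0r addr0 /=.
  congr (_ + _); rewrite fct_sumE; apply: eq_bigr => k _.
  by rewrite /GRing.scale/= /bump /= add1n; ring.
rewrite -[cos_taylor (phi + pi / 2) K h]add0r.
apply: is_deriveD; rewrite /cos_taylor; apply: is_derive_sum => k.
have dX := @is_deriveX R R id k.+1 h 1 1 (is_derive_id h 1).
have -> : (fun h : R => ((k.+1)`!%:R^-1 * cos (phi + k.+1%:R * (pi / 2))) *: h ^+ k.+1)
   = ((k.+1)`!%:R^-1 * cos (phi + k.+1%:R * (pi / 2))) *: (id ^+ k.+1 : R -> R).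
  by apply/funext => x; rewrite !fctE.
have := is_deriveZ ((k.+1)`!%:R^-1 * cos (phi + k.+1%:R * (pi / 2))) dX.
move=> /is_derive_eq; apply.
rewrite /GRing.scale/= mulr1 -addrA -{2}[pi / 2]mul1r -mulrDl nat1r factS natrM.
have f0 : (k`!)%:R != 0 :> R by rewrite pnatr_eq0 -lt0n fact_gt0.
by field; rewrite f0 nat1r pnatr_eq0.
Qed.

(** The factor 1/K! is dropped: the estimate is only used for small [h]. *)
Lemma cos_taylor_le phi K h : `|cos (phi + h) - cos_taylor phi K h| <= `|h| ^+ K.
Proof.
elim: K phi h => [|K ih] phi h.
  by rewrite /cos_taylor big_ord0 subr0 expr0 cos_max.
pose f x := cos (phi + x) - cos_taylor phi K.+1 x.
pose df x := cos (phi + pi / 2 + x) - cos_taylor (phi + pi / 2) K x.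
have dfE (x : R) : is_derive x 1 f (df x).
  apply: is_deriveB; last exact: is_derive_cos_taylor.
  have := is_derive_comp_affine (is_derive_cos (1 * x + phi)).
  rewrite (_ : (fun t => _) = (fun t => cos (phi + t))); last first.
    by apply/funext => t; rewrite mul1r addrC.
  move=> /is_derive_eq; apply.
  by rewrite mul1r mul1r addrAC cosDpihalf addrC.
have f0 : f 0 = 0.
  rewrite /f /cos_taylor big_ord_recl big1 ?addr0 => [|k _].
    by rewrite expr0 fact0 divr1 mul1r mul0r addr0 subrr.
  by rewrite /= /bump /= add1n expr0n/= !mul0r.
have cf : continuous f by exact: is_derive_continuous dfE.
have key (a b : R) : a <= b -> exists2 c, c \in `[a, b] & f b - f a = df c * (b - a).
  by move=> ab; apply: MVT_segment => //; exact: continuous_subspaceT.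
rewrite -/(f h) exprSr; have [h0|/ltW h0] := leP 0 h.
  have [c] := key _ _ h0; rewrite in_itv/= f0 !subr0 => /andP[c0 ch] ->.
  rewrite normrM ler_wpM2r//; apply: le_trans (ih _ _) _.
  by rewrite lerXn2r ?nnegrE// !ger0_norm.
have [c] := key _ _ h0; rewrite in_itv/= f0 !sub0r => /andP[ch c0] /eqP.
rewrite eqr_oppLR => /eqP ->; rewrite mulrN opprK normrM ler_wpM2r//.
apply: le_trans (ih _ _) _.
by rewrite lerXn2r ?nnegrE// !ler0_norm// lerN2.
Qed.

End CosineTaylor.

Section SmallFunctionals.
Context {R : realType}.
Variables (U : Type) (delta : U -> R) (L : U -> (R -> R) -> R) (r A : R).
Hypotheses (r0 : 0 < r) (A0 : 0 <= A).
Implicit Types (g : R -> R) (w th : R).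
Hypothesis LD : forall u g g', continuous g -> continuous g' ->
  L u (fun x => g x + g' x) = L u g + L u g'.
Hypothesis LZ : forall u c g, continuous g -> L u (fun x => c * g x) = c * L u g.
Hypothesis L_le : forall u g e, continuous g ->
  (forall x, x \in `]- r, r[ -> `|g x| <= e) -> `|L u g| <= A * e.

(** The parameter u ranges over admissible functions and delta u is the size of
    their data: g is small when pairing with g is controlled by the data,
    uniformly in u. *)
Definition small g : Prop := continuous g /\
  forall c : R, 0 < c -> exists2 d0 : R, 0 < d0 &
    forall u, delta u <= d0 -> `|L u g| <= c.

Lemma smallD g g' : small g -> small g' -> small (fun x => g x + g' x).
Proof.
move=> [cg sg] [cg' sg']; split; first by move=> x; apply: cvgD; [exact: cg|exact: cg'].
move=> c c0; have c2 : 0 < c / 2 by rewrite divr_gt0.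
have [d d0 Hd] := sg _ c2; have [d' d'0 Hd'] := sg' _ c2.
exists (Num.min d d') => [|u]; first by rewrite lt_min d0.
rewrite le_min => /andP[ud ud']; rewrite LD//.
apply: le_trans (ler_normD _ _) _; have := Hd u ud; have := Hd' u ud'; lra.
Qed.

Lemma smallZ a g : small g -> small (fun x => a * g x).
Proof.
move=> [cg sg]; split; first by move=> x; apply: cvgM; [exact: cvg_cst|exact: cg].
move=> c c0; have a0 : 0 < `|a| + 1 by rewrite ltr_wpDl.
have [|d d0 Hd] := sg (c / (`|a| + 1)); first by rewrite divr_gt0.
exists d => // u /Hd; rewrite ler_pdivlMr// => h.
rewrite LZ// normrM mulrC; apply: le_trans h.
by rewrite ler_wpM2l// lerDl.
Qed.

Lemma small0 : small (fun=> 0).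
Proof.
split; first by move=> x; exact: cvg_cst.
move=> c c0; exists 1 => // u _; apply: le_trans (@L_le u _ 0 _ _) _.
- by move=> x; exact: cvg_cst.
- by move=> x _; rewrite normr0.
- by rewrite mulr0 ltW.
Qed.

Lemma small_sum K (F : nat -> R -> R) : (forall k, small (F k)) ->
  small (fun x => \sum_(k < K) F k x).
Proof.
move=> sF; elim: K => [|K ih].
  by under eq_fun do rewrite big_ord0; exact: small0.
by under eq_fun do rewrite big_ord_recr; exact: smallD.
Qed.

(** Uniform limits, because a pairing is at most A times the supremum. *)
Lemma small_lim g : continuous g ->
  (forall e : R, 0 < e -> exists2 g', small g' &
     forall x, x \in `]- r, r[ -> `|g x - g' x| <= e) -> small g.
Proof.
move=> cg H; split=> // c c0.
have A1 : 0 < A + 1 by rewrite ltr_wpDl.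
have [|g' [cg' sg'] gg'] := H (c / 2 / (A + 1)); first by rewrite !divr_gt0.
have [|d d0 Hd] := sg' (c / 2); first by rewrite divr_gt0.
exists d => // u /Hd h.
have cN : continuous (fun x => (-1) * g' x).
  by move=> x; apply: cvgM; [exact: cvg_cst|exact: cg'].
have cB : continuous (fun x => g x + (-1) * g' x).
  by move=> x; apply: cvgD; [exact: cg|exact: cN].
have := L_le u cB (e := c / 2 / (A + 1)).
have gg'' x : x \in `]- r, r[ -> `|g x + (-1) * g' x| <= c / 2 / (A + 1).
  by move=> xr; rewrite mulN1r gg'.
move=> /(_ gg''); rewrite LD// LZ// mulN1r => h'.
have : A * (c / 2 / (A + 1)) <= c / 2.
  rewrite mulrCA ler_piMr ?divr_ge0 ?(ltW c0)// ler_pdivrMr// mul1r; lra.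
have := ler_normD (L u g - L u g') (L u g'); rewrite subrK; lra.
Qed.

Definition pow_cos (j : nat) w th : R -> R := fun x => x ^+ j * cos (w * x + th).

Lemma continuous_pow_cos j w th : continuous (pow_cos j w th).
Proof.
move=> x; apply: cvgM; first exact: exprn_continuous.
apply: continuous_comp; [exact: continuous_affine|exact: continuous_cos].
Qed.

Lemma pow_cos_taylor_le j w th s K x : x \in `]- r, r[ ->
  `|pow_cos j (w + s) th x - \sum_(k < K) s ^+ k / k`!%:R *
      pow_cos (j + k) w (th + k%:R * (pi / 2)) x| <= r ^+ j * (`|s| * r) ^+ K.
Proof.
rewrite in_itv/= => /andP[rx xr].
have xn : `|x| <= r by rewrite ler_norml !ltW.
have -> : \sum_(k < K) s ^+ k / k`!%:R * pow_cos (j + k) w (th + k%:R * (pi / 2)) x =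
    x ^+ j * cos_taylor (w * x + th) K (s * x).
  rewrite /cos_taylor mulr_sumr; apply: eq_bigr => k _.
  by rewrite /pow_cos exprD exprMn addrA; ring.
rewrite /pow_cos -mulrBr normrM normrX; apply: ler_pM => //.
  by rewrite lerXn2r ?nnegrE// ltW.
rewrite (_ : (w + s) * x + th = w * x + th + s * x); last by ring.
apply: le_trans (cos_taylor_le _ _ _) _.
by rewrite lerXn2r ?nnegrE ?mulr_ge0 ?(ltW r0)// normrM ler_wpM2l.
Qed.

Variables (w1 w2 : R).
Hypothesis w12 : w1 < w2.
Hypothesis base : forall w th, w \in `]w1, w2[ -> small (pow_cos 0 w th).

(** Multiplication by x is a limit of difference quotients in the frequency. *)
Lemma small_moment j w th : w \in `]w1, w2[ -> small (pow_cos j w th).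
Proof.
elim: j w th => [|j ih] w th ww; first exact: base.
apply: small_lim => [|e e0]; first exact: continuous_pow_cos.
have rj0 : 0 < r ^+ j.+2 by rewrite exprn_gt0.
have [ww1 ww2] : w1 < w /\ w < w2 by move: ww; rewrite in_itv => /andP.
pose s := Num.min ((w2 - w) / 2) (e / r ^+ j.+2).
have s0 : 0 < s by rewrite lt_min !divr_gt0 ?subr_gt0.
have ws : w + s \in `]w1, w2[.
  rewrite in_itv/=; apply/andP; split; first by rewrite (lt_trans ww1)// ltrDl.
  have : s <= (w2 - w) / 2 by rewrite ge_min lexx.
  lra.
exists (fun x => s^-1 * (pow_cos j (w + s) (th - pi / 2) x +
                         (-1) * pow_cos j w (th - pi / 2) x)).
  by apply: smallZ; apply: smallD; [exact: ih|apply: smallZ; exact: ih].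
move=> x xr; have := pow_cos_taylor_le j w (th - pi / 2) s 2 xr.
rewrite !big_ord_recr big_ord0 /= add0r addn0 addn1 expr0 expr1 fact0 factS fact0.
rewrite muln1 !divr1 mul1r mul0r addr0 mul1r subrK.
set X := pow_cos j (w + s) _ x; set Y := pow_cos j w _ x; set Z := pow_cos j.+1 w th x.
move=> h; have -> : Z - s^-1 * (X + -1 * Y) = - (s^-1 * (X - (Y + s * Z))).
  by field; rewrite lt0r_neq0.
rewrite normrN normrM gtr0_norm ?invr_gt0// ler_pdivrMl//; apply: le_trans h _.
have : s <= e / r ^+ j.+2 by rewrite ge_min lexx orbT.
rewrite ler_pdivlMr// => hs.
rewrite (gtr0_norm s0) exprMn mulrCA -exprD addn2 expr2 -mulrA ler_wpM2l// ltW//.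
Qed.

(** For |s| r <= 1/2 the Taylor series in s converges uniformly on ]- r, r[,
    and its terms are moments at frequency w. *)
Lemma small_shift w s : `|s| * r <= 2^-1 ->
  (forall j th, small (pow_cos j w th)) -> forall j th, small (pow_cos j (w + s) th).
Proof.
move=> sr sw j th; apply: small_lim => [|e e0]; first exact: continuous_pow_cos.
have rj0 : 0 < r ^+ j by rewrite exprn_gt0.
have : (r ^+ j * 2^-1 ^+ K) @[K --> \oo] --> (0 : R).
  rewrite -(mulr0 (r ^+ j)); apply: cvgM; first exact: cvg_cst.
  by apply: cvg_expr; rewrite ger0_norm ?invf_lt1 ?ltr1n.
move=> /cvgrPdist_lt/(_ e e0)[K _ /(_ K (leqnn K))] /=; rewrite sub0r normrN => hK.
exists (fun x => \sum_(k < K) s ^+ k / k`!%:R * pow_cos (j + k) w (th + k%:R * (pi / 2)) x).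
  by apply: (@small_sum K (fun k x => s ^+ k / k`!%:R * pow_cos (j + k) w (th + k%:R * (pi / 2)) x)) => k;
    apply: smallZ.
move=> x xr; apply: le_trans (pow_cos_taylor_le _ _ _ _ _ xr) _.
apply: le_trans (le_trans (ler_norm _) (ltW hK)).
rewrite ler_wpM2l ?(ltW rj0)// lerXn2r ?nnegrE ?mulr_ge0 ?(ltW r0)//.
Qed.

(** Any frequency is reached from the band in finitely many admissible
    shifts. *)
Lemma small_cos a th : small (pow_cos 0 a th).
Proof.
pose w := (w1 + w2) / 2.
have ww : w \in `]w1, w2[ by rewrite in_itv/= /w !midf_lt.
have [m Hm] : exists m : nat, 2 * `|a - w| * r <= m.+1%:R.
  by exists (Num.truncn (2 * `|a - w| * r)); apply: ltW; exact: truncnS_gt.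
pose s := (a - w) / m.+1%:R.
have sr : `|s| * r <= 2^-1.
  rewrite /s normrM normfV normr_nat mulrAC ler_pdivrMr//.
  by rewrite -(ler_pM2l (ltr0n R 2)) !mulrA mulfV// mul1r.
have H k : forall j th', small (pow_cos j (w + k%:R * s) th').
  elim: k => [|k ih] j th'.
    by rewrite mul0r addr0; exact: small_moment.
  rewrite -natr1 mulrDl mul1r addrA; exact: small_shift.
have := H m.+1 0%N th; rewrite /s mulrCA mulfV ?mulr1 ?pnatr_eq0//.
by rewrite addrC subrK.
Qed.

End SmallFunctionals.

(** * The data as pairings with trigonometric functions *)

Section ScaleIntegral.
Context d (T : measurableType d) (R : realType).
Variables (mu : {measure set T -> \bar R}) (D : set T).
Hypothesis mD : measurable D.

(** When f is not integrable both sides are 0. *)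
Lemma RintegralZl_measurable (c : R) (f : T -> R) : measurable_fun D f ->
  \int[mu]_(x in D) (c * f x) = c * \int[mu]_(x in D) f x.
Proof.
move=> mf; have [fi|nfi] := pselect (mu.-integrable D (EFin \o f)).
  exact: RintegralZl.
have zero (g : T -> R) : measurable_fun D g -> ~ mu.-integrable D (EFin \o g) ->
    \int[mu]_(x in D) g x = 0.
  move=> mg ng; rewrite /Rintegral.
  have : ~~ ((\int[mu]_(x in D) (g x)%:E)%E \is a fin_num).
    apply/negP => h; apply: ng; apply/integrableP; split.
      exact/measurable_EFinP.
    by rewrite -integral_fin_num_abs in h.
  by rewrite fin_numE negb_and !negbK => /orP[] /eqP ->.
rewrite (zero f)// mulr0; have [->|c0] := eqVneq c 0.
  under eq_Rintegral do rewrite mul0r.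
  by rewrite Rintegral_cst// mul0r.
apply: zero; first exact: measurable_funM.
move=> h; apply: nfi.
rewrite (_ : EFin \o f = (fun x => (c^-1)%:E * (c * f x)%:E)%E).
  by apply: integrableZl.
by apply/funext => x /=; rewrite -EFinM mulKf.
Qed.

End ScaleIntegral.

Section FourierData.
Context {R : realType}.
Variable r : R.
Hypothesis r0 : 0 < r.
Local Notation leb := (@lebesgue_measure R).
Local Notation D1 := (`]- r, r[%classic : set (measurableTypeR R)).
Local Notation D2 := (`]0, 1[%classic : set (measurableTypeR R)).
Local Notation D := (D1 `*` D2).
Local Notation T := (measurableTypeR R * measurableTypeR R)%type.
Local Notation sqint := (sqint (leb2 R) D).
Local Notation ip := (ip (leb2 R) D).

Let rr : - r < r. Proof. by rewrite gtrN. Qed.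
Let mD : measurable D := measurable_rect (- r) r 0 1.
Let finD : (leb2 R D < +oo)%E := leb2_rect_fin rr ltr01.

Definition cosw (w : R) : R -> R := fun x => cos (w * x).
Definition sinw (w : R) : R -> R := fun x => sin (w * x).

Lemma continuous_cosw w : continuous (cosw w).
Proof.
move=> x; apply: continuous_comp; last exact: continuous_cos.
by apply: cvgM; [exact: cvg_cst|exact: cvg_id].
Qed.

Lemma continuous_sinw w : continuous (sinw w).
Proof.
move=> x; apply: continuous_comp; last exact: continuous_sin.
by apply: cvgM; [exact: cvg_cst|exact: cvg_id].
Qed.

Lemma continuous_cos_basis n : continuous (@cos_basis R n).
Proof.
case: n => [|n] x; first exact: cvg_cst.
by apply: cvgM; [exact: cvg_cst|exact: continuous_cosw].
Qed.

(** The bound 2 stands for the square root of 2. *)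
Lemma cos_basis_le2 n (y : R) : `|cos_basis n y| <= 2.
Proof.
case: n => [|n] /=; first by rewrite normr1 ler1n.
rewrite normrM -[leRHS]mulr1; apply: ler_pM => //; last exact: cos_max.
rewrite ger0_norm ?sqrtr_ge0// -[leRHS]ger0_norm// -sqrtr_sqr ler_sqrt//; lra.
Qed.

Lemma continuous_bounded_itv (g : R -> R) : continuous g ->
  exists C, forall x, x \in `]- r, r[ -> `|g x| <= C.
Proof.
move=> cg; have [|c _ Hc] := @EVT_max R (fun x => `|g x|) _ _ (ltW rr).
  by apply: continuous_subspaceT => x; apply: cvg_norm; exact: cg.
by exists `|g c| => x xr; apply: Hc; exact: subset_itv_oo_cc.
Qed.

Lemma sqint_tensor_basis (g : R -> R) n : continuous g -> sqint (tensor g (cos_basis n)).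
Proof.
move=> cg; have [C gC] := continuous_bounded_itv cg.
apply: (@sqint_bounded _ _ _ _ _ mD finD _ (C * 2)).
  by apply: measurable_tensor => //; exact: continuous_cos_basis.
move=> [x y] [/= xr _]; rewrite /tensor normrM ler_pM ?cos_basis_le2//.
exact: gC.
Qed.

Definition pairing n (u : T -> R) (g : R -> R) : R := ip u (tensor g (cos_basis n)).

Lemma pairingE n u g : pairing n u g = ip u (tensor g (cos_basis n)).
Proof. by []. Qed.

(** Pairing the n-th mode, extended by 0, with g is a double integral. This
    makes the data linear in the function without any statement about the modes
    at individual points. *)
Lemma pairing_mode n (u : T -> R) (g : R -> R) : sqint u -> continuous g ->
  \int[leb]_z ((mode u n \_ `]- r, r[) z * g z) = pairing n u g.
Proof.
move=> su cg; have sg := sqint_tensor_basis n cg.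
rewrite pairingE ipE /leb2 Rfubini//; last exact: sqint_mul mD _ _ su sg.
rewrite [RHS]Rintegral_mkcond; apply: eq_Rintegral => x _; rewrite /patch.
case: ifPn => xr; last by rewrite mul0r.
rewrite mulrC /mode -RintegralZl_measurable//.
  by apply: eq_Rintegral => y _; rewrite /tensor/=; ring.
apply: measurable_funM; last first.
  by apply: measurable_funTS; apply: continuous_measurable_fun; exact: continuous_cos_basis.
have [mu _] := su.
have : measurable_fun setT (u \_ D) by exact/(measurable_restrictT _ mD).
move=> mu'; have mux := measurableT_comp mu' (pair1_measurable x).
apply: (eq_measurable_fun ((u \_ D) \o pair x)).
  by move=> y yD; rewrite /patch /= in_setX xr yD.
exact: measurable_funTS.
Qed.

Lemma dataE n (h : T -> R) (w : R) : sqint h ->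
  data r h n w = ((0 +i* 1) / (2 * w)%:C *
    (pairing n h (cosw w) +i* pairing n h (sinw w)))%C.
Proof.
move=> sh.
have cc := @continuous_cosw w; have cs := @continuous_sinw w.
rewrite /data /Gamma /cintegral -!pairing_mode//.
congr (_ * _); congr (Complex _ _); apply: eq_Rintegral => z _ /=.
  by rewrite mul0r subr0.
by rewrite mul0r addr0.
Qed.

(** The modulus is a complex number whose imaginary part is 0. *)
Lemma sqr_Re_normc (z : R[i]) : complex.Re `|z| ^+ 2 = complex.Re z ^+ 2 + complex.Im z ^+ 2.
Proof.
by case: z => a b; rewrite normc_def/= sqr_sqrtr// addr_ge0// sqr_ge0.
Qed.

Lemma pairingB n (h g : T -> R) (f : R -> R) : sqint h -> sqint g ->
  continuous f ->
  pairing n (fun x => h x - g x) f = pairing n h f - pairing n g f.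
Proof. by move=> sh sg cf; rewrite /pairing ipBl//; exact: sqint_tensor_basis. Qed.

Lemma data_diff_norm n (h g : T -> R) (w : R) : 0 < w -> sqint h -> sqint g ->
  w ^+ 2 * complex.Re `|data r h n w - data r g n w| ^+ 2 =
  (pairing n (fun x => h x - g x) (cosw w) ^+ 2 +
   pairing n (fun x => h x - g x) (sinw w) ^+ 2) / 4.
Proof.
move=> w0 sh sg; rewrite !dataE// sqr_Re_normc.
have cc := @continuous_cosw w; have cs := @continuous_sinw w.
rewrite !pairingB//.
set a := pairing n h (cosw w); set b := pairing n h (sinw w).
set c := pairing n g (cosw w); set e := pairing n g (sinw w).
rewrite -fmorphV /=.
by field; rewrite lt0r_neq0.
Qed.

End FourierData.

(** * Smallness of all frequencies from a small band *)

Section BandLimitedSmallness.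
Context {R : realType}.
Variables (r kmax B : R) (N : nat).
Hypotheses (r0 : 0 < r) (hN : N%:R < kmax / pi) (B0 : 0 <= B).
Local Notation leb := (@lebesgue_measure R).
Local Notation D1 := (`]- r, r[%classic : set (measurableTypeR R)).
Local Notation D2 := (`]0, 1[%classic : set (measurableTypeR R)).
Local Notation D := (D1 `*` D2).
Local Notation T := (measurableTypeR R * measurableTypeR R)%type.
Local Notation sqint := (sqint (leb2 R) D).
Local Notation ip := (ip (leb2 R) D).
Local Notation pairing := (pairing r).

Let rr : - r < r. Proof. by rewrite gtrN. Qed.
Let mD : measurable D := measurable_rect (- r) r 0 1.
Let finD : (leb2 R D < +oo)%E := leb2_rect_fin rr ltr01.
Let A : R := 2 * r + B.
Let A0 : 0 <= A. Proof. by rewrite addr_ge0// mulr_ge0// ltW. Qed.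

(** With the square integral of u at most B, the integral of |u| is at most
    A / 2, because 2 |u| <= 1 + u^2; the basis functions are bounded by 2. *)
Lemma pairing_le n (u : T -> R) (g : R -> R) (e : R) : sqint u -> ip u u <= B -> continuous g ->
  (forall x, x \in `]- r, r[ -> `|g x| <= e) -> `|pairing n u g| <= A * e.
Proof.
move=> su uB cg ge.
have e0 : 0 <= e by apply: le_trans (ge 0 _); rewrite // in_itv/= oppr_lt0 r0.
have sg := sqint_tensor_basis r0 n cg.
have i1 := sqint_mul mD su sg.
have i3 : (leb2 R).-integrable D (EFin \o (fun p => 1 + u p * u p)) :=
  integrableD mD (sqint_integrable mD finD (sqint_cst mD finD 1)) (sqint_mul mD su su).
have i2 : (leb2 R).-integrable D (EFin \o (fun p => e * (1 + u p * u p))).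
  rewrite (_ : EFin \o _ = (fun p => e%:E * (EFin (1 + u p * u p))%R)%E); last first.
    by apply/funext => p /=; rewrite EFinM.
  exact: integrableZl.
apply: (@le_trans _ _ (\int[leb2 R]_(p in D) (e * (1 + u p * u p)))).
  apply: le_trans (le_normr_Rintegral mD i1) _.
  apply: le_Rintegral => //; first exact: integrable_norm.
  move=> [x y] [/= xr _]; rewrite !normrM mulrCA.
  apply: ler_pM; [exact: normr_ge0|by rewrite mulr_ge0|exact: ge|].
  apply: (@le_trans _ _ (`|u (x, y)| * 2)); first by rewrite ler_wpM2l ?cos_basis_le2.
  have := sqr_ge0 (`|u (x, y)| - 1).
  have <- : `|u (x, y)| * `|u (x, y)| = u (x, y) * u (x, y).
    by rewrite -normrM ger0_norm// -expr2 sqr_ge0.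
  nra.
rewrite RintegralZl//.
rewrite mulrC ler_wpM2r// RintegralD//; last 2 first.
- exact: (sqint_integrable mD finD (sqint_cst mD finD 1)).
- exact: sqint_mul.
apply: lerD => //; rewrite Rintegral_cst// mul1r leb2_rect//=; lra.
Qed.

Lemma pairingD n (u : T -> R) (g g' : R -> R) : sqint u -> continuous g -> continuous g' ->
  pairing n u (fun x => g x + g' x) = pairing n u g + pairing n u g'.
Proof.
move=> su cg cg'; rewrite !pairingE ![ip u _]ipC.
rewrite -ipDl//; [|exact: sqint_tensor_basis..].
by apply: eq_ip => // p _; rewrite /tensor mulrDl.
Qed.

Lemma pairingZ n (u : T -> R) (c : R) (g : R -> R) : sqint u -> continuous g ->
  pairing n u (fun x => c * g x) = c * pairing n u g.
Proof.
move=> su cg; rewrite !pairingE ![ip u _]ipC.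
rewrite -ipZl//; last exact: sqint_tensor_basis.
by apply: eq_ip => // p _; rewrite /tensor mulrA.
Qed.

(** The integrand of the data norm: w^2 |d_n(w)|^2, by [data_diff_norm]. *)
Definition spectral_energy n (u : T -> R) (w : R) : R :=
  (pairing n u (cosw w) ^+ 2 + pairing n u (sinw w) ^+ 2) / 4.

Definition band_norm (u : T -> R) : R :=
  Num.sqrt (\sum_(0 <= n < N.+1)
    \int[leb]_(w in band kmax n) spectral_energy n u w).

Lemma spectral_energy_ge0 n u w : 0 <= spectral_energy n u w.
Proof. by rewrite divr_ge0// addr_ge0// sqr_ge0. Qed.

Lemma pow_cos0E (w th : R) : pow_cos 0 w th = fun x => cos th * cosw w x + (- sin th) * sinw w x.
Proof.
by apply/funext => x; rewrite /pow_cos expr0 mul1r cosD /cosw /sinw mulrC mulNr (mulrC (sin th)).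
Qed.

Lemma pairing_pow_cos_le n u w th : sqint u ->
  pairing n u (pow_cos 0 w th) ^+ 2 <= 4 * spectral_energy n u w.
Proof.
move=> su; have cc := @continuous_cosw R w; have cs := @continuous_sinw R w.
have cN (c : R) (g : R -> R) : continuous g -> continuous (fun x : R => c * g x : R).
  by move=> cg x; apply: cvgM; [exact: cvg_cst|exact: cg].
rewrite pow_cos0E pairingD//; [|exact: cN..]; rewrite !pairingZ//.
rewrite /spectral_energy mulrCA mulfV ?mulr1//.
set a := pairing _ _ _; set b := pairing _ _ _; have := cos2Dsin2 th.
set c := cos th; set s := sin th => cs1.
have -> : a ^+ 2 + b ^+ 2 = (c * a + - s * b) ^+ 2 + (s * a + c * b) ^+ 2.
  rewrite -[LHS]mul1r -cs1; ring.
by rewrite lerDl sqr_ge0.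
Qed.

Lemma pairing_pow_cos_lip n u w w' th : sqint u -> ip u u <= B ->
  `|pairing n u (pow_cos 0 w th) - pairing n u (pow_cos 0 w' th)| <= A * (r * `|w - w'|).
Proof.
move=> su uB; have cm (v : R) := @continuous_pow_cos R 0 v th.
rewrite -mulN1r -pairingZ// -pairingD//; last first.
  by move=> x; apply: cvgM; [exact: cvg_cst|exact: cm].
apply: pairing_le => //.
  by move=> x; apply: cvgD; [exact: cm|apply: cvgM; [exact: cvg_cst|exact: cm]].
move=> x; rewrite in_itv/= => /andP[rx xr].
have := cos_taylor_le (w' * x + th) 1 ((w - w') * x).
rewrite /cos_taylor big_ord1 expr0 fact0 divr1 mul1r mul0r addr0 expr1.
rewrite (_ : w' * x + th + (w - w') * x = w * x + th); last by ring.
rewrite /pow_cos !expr0 !mul1r mulN1r => /le_trans; apply.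
by rewrite normrM mulrC ler_wpM2r// ler_norml !ltW.
Qed.

Lemma measurable_band n : measurable (band kmax n : set (measurableTypeR R)).
Proof. exact: measurable_itv. Qed.

Lemma spectral_energy_integrable n u : sqint u -> ip u u <= B ->
  leb.-integrable (band kmax n) (EFin \o spectral_energy n u).
Proof.
move=> su uB.
have cont th : continuous (fun w => pairing n u (pow_cos 0 w th)).
  move=> w; apply/cvgrPdist_le => e e0.
  have Ar0 : 0 < A * r + 1 by rewrite ltr_wpDl// mulr_ge0// ltW.
  near=> w'; apply: le_trans (pairing_pow_cos_lip n w w' th su uB) _.
  have : `|w - w'| <= e / (A * r + 1).
    by near: w'; apply: cvgr_dist_le; [exact: cvg_id|rewrite divr_gt0].
  rewrite ler_pdivlMr// mulrA => h; apply: le_trans h.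
  by rewrite mulrC ler_wpM2l// lerDl.
have cE (w : R) : pairing n u (cosw w) = pairing n u (pow_cos 0 w 0).
  by congr pairing; apply/funext => x; rewrite /pow_cos expr0 mul1r addr0.
have sE (w : R) : pairing n u (sinw w) = pairing n u (pow_cos 0 w (- (pi / 2))).
  by congr pairing; apply/funext => x; rewrite /pow_cos expr0 mul1r cosBpihalf.
apply: (@integrable_bounded _ _ _ leb _ _ _ _ (A ^+ 2)).
- exact: measurable_band.
- by apply: leb_itv_fin.
- apply: measurable_funTS; apply: continuous_measurable_fun => w.
  rewrite /spectral_energy; apply: cvgM; last exact: cvg_cst.
  rewrite cE sE !expr2; under eq_fun do rewrite cE sE !expr2.
  by apply: cvgD; apply: cvgM; exact: cont.
- move=> w _; rewrite ger0_norm ?spectral_energy_ge0// /spectral_energy.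
  have h1 : `|pairing n u (cosw w)| <= A.
    rewrite -[leRHS]mulr1; apply: pairing_le => //; first exact: continuous_cosw.
    by move=> x _; exact: cos_max.
  have h2 : `|pairing n u (sinw w)| <= A.
    rewrite -[leRHS]mulr1; apply: pairing_le => //; first exact: continuous_sinw.
    by move=> x _; exact: sin_max.
  have q (t : R) : `|t| <= A -> t ^+ 2 <= A ^+ 2.
    by move=> tA; rewrite -[t ^+ 2]ger0_norm ?sqr_ge0// normrX lerXn2r ?nnegrE.
  have := q _ h1; have := q _ h2; have := sqr_ge0 A; lra.
Unshelve. all: by end_near. Qed.

(** A lower bound of the energy on a subinterval of one band bounds the whole
    norm from below. *)
Lemma band_norm_ge n u (w1 t : R) (c : R) : (n <= N)%N -> sqint u -> ip u u <= B ->
  0 < t -> 0 <= c -> `]w1, w1 + t[%classic `<=` band kmax n ->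
  (forall w, w \in `]w1, w1 + t[ -> c <= spectral_energy n u w) ->
  c * t <= band_norm u ^+ 2.
Proof.
move=> nN su uB t0 c0 sub cw.
have S0 m : 0 <= \int[leb]_(w in band kmax m) spectral_energy m u w.
  by apply: Rintegral_ge0 => w _; exact: spectral_energy_ge0.
rewrite sqr_sqrtr ?sumr_ge0//.
rewrite (bigD1_seq n) ?mem_index_iota ?iota_uniq//=.
apply: (@le_trans _ _ (\int[leb]_(w in band kmax n) spectral_energy n u w)); last first.
  by rewrite lerDl sumr_ge0.
have mJ : measurable (`]w1, w1 + t[%classic : set (measurableTypeR R)) by exact: measurable_itv.
have iS := spectral_energy_integrable n su uB.
apply: (@le_trans _ _ (\int[leb]_(w in `]w1, w1 + t[) spectral_energy n u w)).
  have -> : c * t = \int[leb]_(w in `]w1, w1 + t[) c.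
    have wt : w1 < w1 + t by rewrite ltrDl.
    by rewrite Rintegral_cst//; congr (c * _); rewrite (fine_leb_itv wt) addrAC subrr add0r.
  apply: le_Rintegral => //.
  - apply: (@integrable_bounded _ _ _ leb _ _ _ _ `|c|) => //.
    exact: leb_itv_fin.
  - exact: (integrableS (measurable_band n) mJ sub iS).
rewrite Rintegral_mkcond [leRHS]Rintegral_mkcond.
apply: le_Rintegral => //.
- by rewrite -restrict_EFin -integrable_mkcond//; exact: (integrableS (measurable_band n) mJ sub iS).
- by rewrite -restrict_EFin -integrable_mkcond//; exact: measurable_band.
move=> w _; rewrite /patch; case: ifPn => [wJ|_].
  by rewrite mem_set//; apply: sub; exact: set_mem.
by case: ifP => // _; exact: spectral_energy_ge0.
Qed.

Lemma band_lt n : (n <= N)%N ->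
  n%:R * pi < kmax + Num.sqrt (kmax ^+ 2 - n%:R ^+ 2 * pi ^+ 2).
Proof.
move=> nN; apply: (@lt_le_trans _ _ kmax); last by rewrite lerDl sqrtr_ge0.
rewrite -ltr_pdivlMr ?pi_gt0//; apply: le_lt_trans hN.
by rewrite ler_nat.
Qed.

(** If a pairing exceeded e at a frequency of the band, it would exceed e / 2 on
    an interval whose length depends on e, r and B alone, and the energy there
    would exceed a fixed amount. This is the starting point of [small_cos]. *)
Lemma pairing_cos_small n (a th c : R) : (n <= N)%N -> 0 < c ->
  exists2 d0 : R, 0 < d0 & forall u, sqint u -> ip u u <= B -> band_norm u <= d0 ->
    `|pairing n u (pow_cos 0 a th)| <= c.
Proof.
move=> nN c0.
pose U := {u : T -> R | sqint u /\ ip u u <= B}.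
pose L (u : U) := pairing n (sval u).
have [||||_ H] := @small_cos R U (fun u => band_norm (sval u)) L r A r0 A0 _ _ _ _ _
    (band_lt nN) _ a th.
- by move=> [u [su uB]] g g' cg cg'; exact: pairingD.
- by move=> [u [su uB]] k g cg; exact: pairingZ.
- by move=> [u [su uB]] g e cg; exact: pairing_le.
- move=> w ph; set w2 := _ + Num.sqrt _; rewrite in_itv/= => /andP[w1w ww2].
  split; first exact: continuous_pow_cos.
  move=> e e0; have Ar0 : 0 < A * r + 1 by rewrite ltr_wpDl// mulr_ge0// ltW.
  pose t := Num.min ((w2 - w) / 2) (e / 2 / (A * r + 1)).
  have t0 : 0 < t by rewrite lt_min !divr_gt0// subr_gt0.
  have d0 : 0 < (e ^+ 2 / 16) * t by rewrite mulr_gt0// divr_gt0// exprn_gt0.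
  exists (Num.sqrt ((e ^+ 2 / 16) * t / 2)); first by rewrite sqrtr_gt0 divr_gt0.
  move=> [u [su uB]] /= ud; rewrite leNgt; apply/negP => eL.
  have : e ^+ 2 / 16 * t <= band_norm u ^+ 2.
    apply: (@band_norm_ge n u w) => //.
    - by rewrite divr_ge0// sqr_ge0.
    - move=> z /=; rewrite !in_itv/= => /andP[wz zw]; apply/andP; split.
        exact: lt_trans wz.
      apply: lt_le_trans zw _; rewrite -/w2.
      have : t <= (w2 - w) / 2 by rewrite ge_min lexx.
      lra.
    move=> z; rewrite in_itv/= => /andP[wz zw].
    have lip := pairing_pow_cos_lip n w z ph su uB.
    have zt : `|w - z| <= e / 2 / (A * r + 1).
      have tt : t <= e / 2 / (A * r + 1) by rewrite ge_min lexx orbT.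
      apply: le_trans tt; rewrite ler_norml; apply/andP; split; lra.
    have lip2 : A * (r * `|w - z|) <= e / 2.
      move: zt; rewrite ler_pdivlMr// mulrA => h; apply: le_trans h.
      by rewrite mulrC ler_wpM2l// lerDl.
    have := pairing_pow_cos_le n z ph su.
    set P := pairing n u (pow_cos 0 z ph); set Q := pairing n u (pow_cos 0 w ph) in lip eL *.
    have QP : `|Q| <= `|P| + `|Q - P| by rewrite addrC -{1}(subrK P Q) ler_normD.
    have P2 : e / 2 <= `|P| by have : `|Q - P| <= e / 2 := le_trans lip lip2; lra.
    have : (e / 2) ^+ 2 <= P ^+ 2.
      by rewrite -[P ^+ 2]ger0_norm ?sqr_ge0// normrX lerXn2r ?nnegrE// divr_ge0// ltW.
    rewrite (_ : (e / 2) ^+ 2 = e ^+ 2 / 4); last by field.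
    lra.
  have : band_norm u ^+ 2 <= (e ^+ 2 / 16) * t / 2.
    rewrite -[leRHS]sqr_sqrtr; last by rewrite divr_ge0// ltW.
    by rewrite lerXn2r ?nnegrE ?sqrtr_ge0.
  lra.
have [d0 d00 Hd] := H _ c0; exists d0 => // u su uB ud.
exact: (Hd (exist _ u (conj su uB)) ud).
Qed.

End BandLimitedSmallness.

(** * Sobolev norms and the spectral Poincare inequality *)

Section NormsAsPairings.
Context {R : realType}.
Local Notation T := (measurableTypeR R * measurableTypeR R)%type.
Variable D : set T.
Hypothesis mD : measurable D.
Implicit Types f g : T -> R.

Lemma inL2_sqint f : inL2 D f -> sqint (leb2 R) D f.
Proof.
move=> fL; split.
  apply/(measurable_restrictT _ mD); move: fL; rewrite /inL2 inE => /andP[].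
  by rewrite inE.
have := Lfun2_integrable_sqr fL.
rewrite [X in integrable _ _ X](_ : _ = ((EFin \o (fun p => f p ^+ 2)) \_ D)).
  by rewrite -integrable_mkcond.
apply/funext => p; rewrite /patch /=; case: ifP => //.
by rewrite expr0n.
Qed.

Lemma L2norm_sqr f : sqint (leb2 R) D f -> L2norm D f ^+ 2 = ip (leb2 R) D f f.
Proof.
move=> sf; rewrite /L2norm.
have E : (\int[leb2 R]_p (`| (EFin \o (f \_ D)) p | `^ 2)%E)%E = (ip (leb2 R) D f f)%:E.
  rewrite /ip /Rintegral fineK; last first.
    exact: (integrable_fin_num mD (sqint_mul mD sf sf)).
  rewrite [RHS]integral_mkcond; apply: eq_integral => p _.
  transitivity ((`|(f \_ D) p| `^ 2)%R%:E); first by [].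
  rewrite powR_mulrn// real_normK ?num_real// /patch; case: ifP => _.
    by rewrite expr2.
  by rewrite expr0n.
rewrite unlock E poweR_EFin/= powR12_sqrt ?ip_ge0//.
by rewrite sqr_sqrtr// ip_ge0.
Qed.

Lemma weak_partialP i f : (exists g, is_weak_partial D i f g) ->
  is_weak_partial D i f (weak_partial D i f).
Proof. exact: xgetPex. Qed.

Lemma inH1_gradient f (M : R) : 0 <= M -> inH1 D f -> H1norm D f <= M ->
  exists g : bool -> T -> R, [/\ forall i, is_weak_partial D i f (g i),
    forall i, sqint (leb2 R) D (g i) &
    ip (leb2 R) D f f + ip (leb2 R) D (g true) (g true) +
    ip (leb2 R) D (g false) (g false) <= M ^+ 2].
Proof.
move=> M0 [fL wf] H; exists (fun i => weak_partial D i f).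
have wP i := weak_partialP (wf i).
have sg i : sqint (leb2 R) D (weak_partial D i f) := inL2_sqint (proj1 (wP i)).
split=> //.
have sqrt_le (x y z : R) : Num.sqrt (x ^+ 2 + y ^+ 2 + z ^+ 2) <= M ->
    x ^+ 2 + y ^+ 2 + z ^+ 2 <= M ^+ 2.
  have S0 : 0 <= x ^+ 2 + y ^+ 2 + z ^+ 2 by rewrite !addr_ge0// sqr_ge0.
  by move=> h; rewrite -(sqr_sqrtr S0) lerXn2r ?nnegrE// sqrtr_ge0.
have := sqrt_le _ _ _ H.
by rewrite (f_equal2 +%R (f_equal2 +%R (L2norm_sqr (inL2_sqint fL))
  (L2norm_sqr (sg true))) (L2norm_sqr (sg false))).
Qed.

End NormsAsPairings.

Section SpectralPoincare.
Context {R : realType}.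
Variables (a1 b1 a2 b2 : R).
Hypotheses (ab1 : a1 < b1) (ab2 : a2 < b2).
Local Notation leb := (@lebesgue_measure R).
Local Notation D1 := (`]a1, b1[%classic : set (measurableTypeR R)).
Local Notation D2 := (`]a2, b2[%classic : set (measurableTypeR R)).
Local Notation D := (D1 `*` D2).
Local Notation T := (measurableTypeR R * measurableTypeR R)%type.
Local Notation sqint := (sqint (leb2 R) D).
Local Notation ip := (ip (leb2 R) D).
Local Notation cos2 := (cos2 a1 b1 a2 b2).
Local Notation nu2 := (nu2 a1 b1 a2 b2).

Let mD : measurable D := measurable_rect a1 b1 a2 b2.
Let finD : (leb2 R D < +oo)%E := leb2_rect_fin ab1 ab2.

(** Sine indices are shifted by one because the sine of index 0 vanishes. *)
Definition cossin (i : nat * nat) : T -> R := tensor (cosn a1 b1 i.1) (sinn a2 b2 i.2.+1).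
Definition sincos (i : nat * nat) : T -> R := tensor (sinn a1 b1 i.1.+1) (cosn a2 b2 i.2).

Lemma sqint_cossin i : sqint (cossin i).
Proof.
by apply: (@sqint_tensor _ _ _ _ _ ab1 ab2 _ _ 1); [exact: continuous_cosn|exact: continuous_sinn|
  move=> x; exact: cos_max|move=> x; exact: sin_max].
Qed.

Lemma sqint_sincos i : sqint (sincos i).
Proof.
by apply: (@sqint_tensor _ _ _ _ _ ab1 ab2 _ _ 1); [exact: continuous_sinn|exact: continuous_cosn|
  move=> x; exact: sin_max|move=> x; exact: cos_max].
Qed.

Lemma ip_cossin i j :
  ip (cossin i) (cossin j) = if i == j then nu2 (i.1, i.2.+1) else 0.
Proof.
rewrite ip_tensor//; [|exact: sqint_cosn|exact: sqint_sinn|exact: sqint_cosn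
  |exact: sqint_sinn|exact: sqint_cossin|exact: sqint_cossin].
rewrite ip_cosn// ip_sinn//; case: i j => [i1 i2] [j1 j2] /=; rewrite xpair_eqE /nu2/=.
by have [->|_] := eqVneq i1 j1; have [_|_] := eqVneq i2 j2; rewrite /= ?mulr0 ?mul0r.
Qed.

Lemma ip_sincos i j :
  ip (sincos i) (sincos j) = if i == j then nu2 (i.1.+1, i.2) else 0.
Proof.
rewrite ip_tensor//; [|exact: sqint_sinn|exact: sqint_cosn|exact: sqint_sinn
  |exact: sqint_cosn|exact: sqint_sincos|exact: sqint_sincos].
rewrite ip_cosn// ip_sinn//; case: i j => [i1 i2] [j1 j2] /=; rewrite xpair_eqE /nu2/=.
by have [_|_] := eqVneq i1 j1; have [->|_] := eqVneq i2 j2; rewrite /= ?mulr0 ?mul0r.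
Qed.

(** Where k times a coefficient of u is dominated by a coefficient of g in
    another orthogonal family with the same norms, Bessel's inequality for g
    bounds the energy of u. *)
Lemma bessel_tail (e : nat * nat -> T -> R) (nu : nat * nat -> R)
    (phi : nat * nat -> nat * nat) (u g : T -> R) (k : R) (s : seq (nat * nat)) :
  (forall i, sqint (e i)) -> (forall i, 0 < nu i) ->
  (forall i j, ip (e i) (e j) = if i == j then nu i else 0) ->
  sqint g -> 0 < k -> uniq s -> {in s &, injective phi} ->
  (forall i, i \in s -> nu2 i = nu (phi i) /\
    exists2 q, k <= q & q * ip u (cos2 i) = - ip g (e (phi i))) ->
  \sum_(i <- s) ip u (cos2 i) ^+ 2 / nu2 i <= ip g g / k ^+ 2.
Proof.
move=> se nu0 oe sg k0 us inj H.
have uphi : uniq (map phi s) by rewrite map_inj_in_uniq.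
rewrite ler_pdivlMr ?exprn_gt0//.
apply: le_trans (bessel mD finD se nu0 oe sg uphi).
rewrite big_map mulr_suml !big_seq; apply: ler_sum => i si.
have [-> [q kq E]] := H _ si.
rewrite mulrAC ler_wpM2r ?invr_ge0 ?(ltW (nu0 _))//.
rewrite -[leRHS]sqrrN -E exprMn mulrC ler_wpM2r ?sqr_ge0//.
by rewrite lerXn2r ?nnegrE ?(ltW k0)// (le_trans (ltW k0)).
Qed.

(** The coefficients are split into three groups: vertical index above N,
    horizontal index above K, and a finite box. *)
Lemma low_modes_le (u gx gy : T -> R) (K N : nat) (e tau : R) :
  sqint u -> sqint gx -> sqint gy -> 0 < e -> 0 <= tau ->
  (forall m n, freq a1 b1 m * ip u (cos2 (m, n)) =
     - ip gx (tensor (sinn a1 b1 m) (cosn a2 b2 n))) ->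
  (forall m n, freq a2 b2 n * ip u (cos2 (m, n)) =
     - ip gy (tensor (cosn a1 b1 m) (sinn a2 b2 n))) ->
  (forall m n, (m <= K)%N -> (n <= N)%N -> ip u (cos2 (m, n)) ^+ 2 / nu2 (m, n) <= tau) ->
  ip u u <= ip gy gy / freq a2 b2 N.+1 ^+ 2 + ip gx gx / freq a1 b1 K.+1 ^+ 2 +
            (K.+1 * N.+1)%:R * tau + e.
Proof.
move=> su sgx sgy e0 tau0 Ex Ey low.
have [s us H] := cos2_parseval_le ab1 ab2 su e0.
apply: le_trans H _; rewrite lerD2r.
have fgt (a b : R) m : a < b -> 0 < freq a b m.+1.
  by move=> ab; rewrite /freq mulr_gt0// divr_gt0 ?pi_gt0// subr_gt0.
have fle (a b : R) m n : a < b -> (m <= n)%N -> freq a b m <= freq a b n.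
  move=> ab mn; rewrite /freq ler_wpM2r ?ler_nat// divr_ge0 ?pi_ge0// subr_ge0.
  exact: ltW.
rewrite (bigID (fun i => (N < i.2)%N))/= -addrA; apply: lerD.
  rewrite -big_filter.
  apply: (@bessel_tail cossin (fun i => nu2 (i.1, i.2.+1)) (fun i => (i.1, i.2.-1))) => //.
  - exact: sqint_cossin.
  - by move=> i; exact: nu2_gt0.
  - exact: ip_cossin.
  - exact: fgt.
  - exact: filter_uniq.
  - move=> [m n] [m' n']; rewrite !mem_filter/= => /andP[n0 _] /andP[n0' _] [-> nn].
    by rewrite -(ltn_predK n0) -(ltn_predK n0') nn.
  - move=> [m n]; rewrite mem_filter/= => /andP[n0 _]; rewrite (ltn_predK n0); split=> //.
    exists (freq a2 b2 n); first exact: fle.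
    by rewrite Ey /cossin/= (ltn_predK n0).
rewrite (bigID (fun i => (K < i.1)%N))/=; apply: lerD.
  rewrite -big_filter.
  apply: (@bessel_tail sincos (fun i => nu2 (i.1.+1, i.2)) (fun i => (i.1.-1, i.2))) => //.
  - exact: sqint_sincos.
  - by move=> i; exact: nu2_gt0.
  - exact: ip_sincos.
  - exact: fgt.
  - exact: filter_uniq.
  - move=> [m n] [m' n']; rewrite !mem_filter/= => /andP[/andP[_ m0] _] /andP[/andP[_ m0'] _] [mm ->].
    by rewrite -(ltn_predK m0) -(ltn_predK m0') mm.
  - move=> [m n]; rewrite mem_filter/= => /andP[/andP[_ m0] _]; rewrite (ltn_predK m0); split=> //.
    exists (freq a1 b1 m); first exact: fle.
    by rewrite Ex /sincos/= (ltn_predK m0).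
rewrite -big_filter; set s3 := [seq i <- s | _].
have us3 : uniq s3 by exact: filter_uniq.
apply: (@le_trans _ _ (\sum_(i <- s3) tau)).
  rewrite !big_seq; apply: ler_sum => -[m n]; rewrite mem_filter/= -!leqNgt.
  by move=> /andP[/andP[nN mK] _]; exact: low.
rewrite big_const_seq count_predT iter_addr_0 -[leLHS]mulr_natl ler_wpM2r// ler_nat.
have -> : (K.+1 * N.+1)%N = size [seq (m, n) | m <- iota 0 K.+1, n <- iota 0 N.+1].
  by rewrite size_allpairs !size_iota.
apply: uniq_leq_size => // -[m n]; rewrite mem_filter -!leqNgt => /andP[/andP[nN mK] _].
by apply: allpairs_f; rewrite mem_iota add0n.
Qed.

End SpectralPoincare.

(** * The stability estimate *)

Section LowModes.
Context {R : realType}.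
Variables (r kmax B : R) (N : nat).
Hypotheses (r0 : 0 < r) (hN : N%:R < kmax / pi) (B0 : 0 <= B).
Local Notation D1 := (`]- r, r[%classic : set (measurableTypeR R)).
Local Notation D2 := (`]0, 1[%classic : set (measurableTypeR R)).
Local Notation D := (D1 `*` D2).
Local Notation T := (measurableTypeR R * measurableTypeR R)%type.
Local Notation sqint := (sqint (leb2 R) D).
Local Notation ip := (ip (leb2 R) D).
Local Notation cos2 := (cos2 (- r) r 0 1).

Let rr : - r < r. Proof. by rewrite gtrN. Qed.
Let mD : measurable D := measurable_rect (- r) r 0 1.

Lemma cos_basisE n : exists2 k : R, 1 <= k &
  @cos_basis R n = fun y => k * cosn 0 1 n y.
Proof.
case: n => [|n].
  by exists 1 => //; apply/funext => y; rewrite /cosn /freq !mul0r cos0 mulr1.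
exists (Num.sqrt 2); first by rewrite -[leLHS]sqrtr1 ler_sqrt// ler1n.
by apply/funext => y; rewrite /cosn /freq /= !subr0 divr1.
Qed.

Lemma ip_cos2_le (u : T -> R) m n : sqint u ->
  `|ip u (cos2 (m, n))| <= `|pairing r n u (cosn (- r) r m)|.
Proof.
move=> su; have [k k1 E] := cos_basisE n.
have -> : pairing r n u (cosn (- r) r m) = k * ip u (cos2 (m, n)).
  rewrite pairingE ipC [ip u _]ipC -ipZl//; last exact: (sqint_cos2 rr ltr01).
  by apply: eq_ip => // p _; rewrite cos2E /tensor/= E; ring.
by rewrite normrM ler_peMl// ger0_norm// (le_trans ler01).
Qed.

Lemma low_modes_small (s : seq (nat * nat)) (c : nat * nat -> R) :
  (forall i, 0 < c i) -> (forall i, i \in s -> (i.2 <= N)%N) ->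
  exists2 d0 : R, 0 < d0 & forall u, sqint u -> ip u u <= B ->
    band_norm r kmax N u <= d0 -> forall i, i \in s -> `|ip u (cos2 i)| <= c i.
Proof.
move=> c0; elim: s => [|[m n] s ih] sN; first by exists 1.
have [|d d0 Hd] := ih; first by move=> i si; apply: sN; rewrite inE si orbT.
have nN : (n <= N)%N by apply: (sN (m, n)); rewrite mem_head.
have [d' d'0 Hd'] := pairing_cos_small r0 hN B0 (freq (- r) r m)
  (freq (- r) r m * r) nN (c0 (m, n)).
exists (Num.min d d'); first by rewrite lt_min d0.
move=> u su uB; rewrite le_min => /andP[ud ud'] i; rewrite inE => /predU1P[->|si]; last exact: Hd.
apply: le_trans (ip_cos2_le m n su) _; have := Hd' u su uB ud'.
congr (`|pairing r n u _| <= _); apply/funext => x.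
by rewrite /pow_cos /cosn expr0 mul1r opprK mulrDr.
Qed.

(** The horizontal derivative leaves finitely many coefficients of vertical index
    at most N to be estimated, and a common threshold on the data makes all of
    them small. *)
Lemma small_band_L2_le (c0 : R) : (1 <= N)%N -> 0 < c0 ->
  exists2 d0 : R, 0 < d0 & forall u gx gy, sqint u -> sqint gx -> sqint gy ->
    (forall m n, freq (- r) r m * ip u (cos2 (m, n)) =
       - ip gx (tensor (sinn (- r) r m) (cosn 0 1 n))) ->
    (forall m n, freq 0 1 n * ip u (cos2 (m, n)) =
       - ip gy (tensor (cosn (- r) r m) (sinn 0 1 n))) ->
    ip u u + ip gx gx + ip gy gy <= B ->
    band_norm r kmax N u <= d0 ->
    ip u u <= c0 + B / (N%:R * pi) ^+ 2.
Proof.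
move=> N1 c00; have pi0 := pi_gt0 R.
(* K is so large that the horizontal frequencies above K cost at most c0 / 4. *)
pose f1 : R := pi / (r - - r).
have f10 : 0 < f1 by rewrite divr_gt0// subr_gt0.
have f12 : 0 < f1 ^+ 2 by rewrite exprn_gt0.
pose K := Num.truncn (B / f1 ^+ 2 * 4 / c0).
have HK : B / freq (- r) r K.+1 ^+ 2 <= c0 / 4.
  have k1 : 1 <= K.+1%:R :> R by rewrite ler1n.
  have : B / f1 ^+ 2 * 4 / c0 < K.+1%:R by exact: truncnS_gt.
  rewrite ltr_pdivrMr// mulrAC ltr_pdivrMr// => h.
  rewrite /freq -/f1 exprMn ler_pdivrMr; last by rewrite mulr_gt0 ?exprn_gt0.
  have : K.+1%:R <= K.+1%:R ^+ 2 :> R by rewrite expr2 ler_peMl.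
  move=> /(ler_wpM2r (ltW c00))/(ler_wpM2r (ltW f12)); lra.
pose tau := c0 / 2 / (K.+1 * N.+1)%:R.
have tau0 : 0 < tau by rewrite !divr_gt0// ltr0n muln_gt0.
pose box := [seq (m, n) | m <- iota 0 K.+1, n <- iota 0 N.+1].
have nu0 i : 0 < nu2 (- r) r 0 1 i by exact: nu2_gt0.
have [||d0 d00 Hd] := @low_modes_small box (fun i => Num.sqrt (tau * nu2 (- r) r 0 1 i)).
- by move=> i; rewrite sqrtr_gt0 mulr_gt0.
- by move=> _ /allpairsP[[m n] [_ + ->]]; rewrite mem_iota add0n ltnS.
exists d0 => // u gx gy su sgx sgy wx wy uB ud.
have [u0 gx0 gy0] : [/\ 0 <= ip u u, 0 <= ip gx gx & 0 <= ip gy gy].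
  by split; exact: ip_ge0.
have lowtau m n : (m <= K)%N -> (n <= N)%N ->
    ip u (cos2 (m, n)) ^+ 2 / nu2 (- r) r 0 1 (m, n) <= tau.
  move=> mK nN; have mn : (m, n) \in box.
    by apply: allpairs_f; rewrite mem_iota add0n ltnS.
  have uB' : ip u u <= B by lra.
  have h := Hd u su uB' ud _ mn.
  rewrite ler_pdivrMr// -[leLHS]ger0_norm ?sqr_ge0// normrX.
  have tn : 0 <= tau * nu2 (- r) r 0 1 (m, n) by rewrite mulr_ge0// ltW.
  by rewrite -[leRHS](sqr_sqrtr tn) lerXn2r ?nnegrE ?sqrtr_ge0.
have c4 : 0 < c0 / 4 by rewrite divr_gt0.
have low := low_modes_le rr ltr01 su sgx sgy c4 (ltW tau0) wx wy lowtau.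
have tauE : (K.+1 * N.+1)%:R * tau = c0 / 2.
  by rewrite /tau mulrC divfK// pnatr_eq0.
have gB : ip gy gy / freq 0 1 N.+1 ^+ 2 <= B / (N%:R * pi) ^+ 2.
  have N0 : 0 < N%:R :> R by rewrite ltr0n.
  have fN : freq 0 1 N.+1 = N.+1%:R * pi :> R by rewrite /freq subr0 divr1.
  rewrite fN; apply: ler_pM => //; first by rewrite invr_ge0 sqr_ge0.
    by lra.
  rewrite lef_pV2 ?posrE ?exprn_gt0 ?mulr_gt0//.
  by rewrite lerXn2r ?nnegrE ?mulr_ge0 ?ler0n ?(ltW pi0)// ler_wpM2r ?ler_nat// ltW.
have gK : ip gx gx / freq (- r) r K.+1 ^+ 2 <= c0 / 4.
  apply: le_trans HK; rewrite ler_wpM2r ?invr_ge0 ?sqr_ge0//; lra.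
rewrite tauE in low; lra.
Qed.

End LowModes.

Section WeakDerivativeDifference.
Context {R : realType}.
Variable r : R.
Hypothesis r0 : 0 < r.
Local Notation D1 := (`]- r, r[%classic : set (measurableTypeR R)).
Local Notation D2 := (`]0, 1[%classic : set (measurableTypeR R)).
Local Notation D := (D1 `*` D2).
Local Notation T := (measurableTypeR R * measurableTypeR R)%type.
Local Notation sqint := (sqint (leb2 R) D).
Local Notation ip := (ip (leb2 R) D).
Local Notation cos2 := (cos2 (- r) r 0 1).

Let rr : - r < r. Proof. by rewrite gtrN. Qed.
Let mD : measurable D := measurable_rect (- r) r 0 1.

Variables u v g k : T -> R.
Hypotheses (su : sqint u) (sv : sqint v) (sg : sqint g) (sk : sqint k).

Lemma weak_partial_sin_lB m n :
  is_weak_partial D true u g -> is_weak_partial D true v k ->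
  freq (- r) r m * ip (fun p => u p - v p) (cos2 (m, n)) =
  - ip (fun p => g p - k p) (tensor (sinn (- r) r m) (cosn 0 1 n)).
Proof.
move=> wu wv; have s1 := sqint_cos2 rr ltr01 (m, n).
have s2 : sqint (tensor (sinn (- r) r m) (cosn 0 1 n)).
  by apply: (@sqint_tensor _ _ _ _ _ rr ltr01 _ _ 1); [exact: continuous_sinn|
    exact: continuous_cosn|move=> x; exact: sin_max|move=> x; exact: cos_max].
rewrite !ipBl// mulrBr (weak_partial_sin_l rr ltr01 m n wu su sg).
by rewrite (weak_partial_sin_l rr ltr01 m n wv sv sk) opprB opprK addrC.
Qed.

Lemma weak_partial_sin_rB m n :
  is_weak_partial D false u g -> is_weak_partial D false v k ->
  freq 0 1 n * ip (fun p => u p - v p) (cos2 (m, n)) =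
  - ip (fun p => g p - k p) (tensor (cosn (- r) r m) (sinn 0 1 n)).
Proof.
move=> wu wv; have s1 := sqint_cos2 rr ltr01 (m, n).
have s2 : sqint (tensor (cosn (- r) r m) (sinn 0 1 n)).
  by apply: (@sqint_tensor _ _ _ _ _ rr ltr01 _ _ 1); [exact: continuous_cosn|
    exact: continuous_sinn|move=> x; exact: cos_max|move=> x; exact: sin_max].
rewrite !ipBl// mulrBr (weak_partial_sin_r rr ltr01 m n wu su sg).
by rewrite (weak_partial_sin_r rr ltr01 m n wv sv sk) opprB opprK addrC.
Qed.

Lemma data_norm_diff kmax N : 
  data_norm N kmax (fun n w => data r u n w - data r v n w) =
  band_norm r kmax N (fun p => u p - v p).
Proof.
rewrite /data_norm /band_norm; congr Num.sqrt; apply: eq_bigr => n _.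
apply: eq_Rintegral => w /set_mem; rewrite /band /= in_itv/= => /andP[wn _].
apply: data_diff_norm => //; apply: le_lt_trans wn.
by rewrite mulr_ge0// ltW// pi_gt0.
Qed.

End WeakDerivativeDifference.

Theorem corollary1 (R : realType) (r kmax : R) (N : nat) (M eps : R)
  (hr : 0 < r) (hk : 0 < kmax) (hN1 : (1 <= N)%N) (hN : N%:R < kmax / pi)
  (hM : 0 < M) (heps0 : 0 < eps) (heps1 : eps < 1) :
  exists xi : R,
    forall h happ : R * R -> R,
      inH1 (Omega r) h -> inH1 (Omega r) happ ->
      H1norm (Omega r) h <= M -> H1norm (Omega r) happ <= M ->
      let delta :=
        data_norm N kmax (fun n w => data r h n w - data r happ n w) in
      L2norm (Omega r) (h \- happ) ^+ 2 <=
        xi * (N.+1%:R `^ eps) * (delta `^ (2 - 2 * eps))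
        + 4 / pi * delta ^+ 2
        + 8 * pi * N.+1%:R / kmax ^+ 2 * M ^+ 2
        + 4 / (N%:R ^+ 2 * pi ^+ 2) * M ^+ 2.
Proof.
have pi0 := pi_gt0 R.
have M2 : 0 < M ^+ 2 by rewrite exprn_gt0.
pose B := 4 * M ^+ 2; have B0 : 0 < B by rewrite mulr_gt0.
pose c0 := 8 * pi * N.+1%:R / kmax ^+ 2 * M ^+ 2.
have c00 : 0 < c0 by rewrite mulr_gt0// divr_gt0 ?exprn_gt0// !mulr_gt0.
have [d0 d00 Hd] := small_band_L2_le hr hN (ltW B0) hN1 c00.
exists (B / d0 `^ (2 - 2 * eps)) => h happ hH1 aH1 hM' aM'; cbv zeta.
have mO : measurable (Omega r : set (measurableTypeR R * measurableTypeR R)).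
  exact: (measurable_rect (- r) r 0 1).
have sh : sqint (leb2 R) (Omega r) h by apply: inL2_sqint => //; case: hH1.
have sa : sqint (leb2 R) (Omega r) happ by apply: inL2_sqint => //; case: aH1.
have [gh [wh sgh hle]] := inH1_gradient mO (ltW hM) hH1 hM'.
have [ga [wa sga ale]] := inH1_gradient mO (ltW hM) aH1 aM'.
pose u p := h p - happ p; pose g i p := gh i p - ga i p.
have su : sqint (leb2 R) (Omega r) u by exact: sqintB.
have sg i : sqint (leb2 R) (Omega r) (g i) by exact: sqintB.
have uB : ip (leb2 R) (Omega r) u u + ip (leb2 R) (Omega r) (g true) (g true) +
    ip (leb2 R) (Omega r) (g false) (g false) <= B.
  have := ip_sqrB_le mO sh sa; have := ip_sqrB_le mO (sgh true) (sga true).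
  have := ip_sqrB_le mO (sgh false) (sga false).
  by rewrite /B /u /g; lra.
have {}Hd := Hd u (g true) (g false) su (sg true) (sg false)
  (fun m n => weak_partial_sin_lB hr sh sa (sgh true) (sga true) m n (wh true) (wa true))
  (fun m n => weak_partial_sin_rB hr sh sa (sgh false) (sga false) m n (wh false) (wa false))
  uB.
rewrite (data_norm_diff hr sh sa kmax N) -/u.
rewrite (_ : h \- happ = u)// L2norm_sqr//.
have [u0 g0 g1] := And3 (ip_ge0 (leb2 R) (Omega r) u)
  (ip_ge0 (leb2 R) (Omega r) (g true)) (ip_ge0 (leb2 R) (Omega r) (g false)).
move: Hd uB u0 g0 g1; set delta := band_norm r kmax N u.
have delta0 : 0 <= delta by rewrite sqrtr_ge0.
move: (ip (leb2 R) (Omega r) u u) (ip (leb2 R) (Omega r) (g true) (g true))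
  (ip (leb2 R) (Omega r) (g false) (g false)) => uu gx gy Hd uB u0 gx0 gy0.
have q1 : 0 <= 4 / pi * delta ^+ 2 by rewrite mulr_ge0 ?sqr_ge0// divr_ge0// ltW.
have q2E : 4 / (N%:R ^+ 2 * pi ^+ 2) * M ^+ 2 = B / (N%:R * pi) ^+ 2.
  by rewrite mulrAC exprMn.
have q2 : 0 <= B / (N%:R * pi) ^+ 2 by rewrite divr_ge0 ?sqr_ge0// ltW.
have xi0 : 0 <= B / d0 `^ (2 - 2 * eps) * N.+1%:R `^ eps * delta `^ (2 - 2 * eps).
  apply: mulr_ge0 (powR_ge0 _ _); apply: mulr_ge0 (powR_ge0 _ _).
  by rewrite divr_ge0 ?powR_ge0 ?(ltW B0).
rewrite -/c0 q2E; have [/Hd|dd] := leP delta d0; first lra.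
have p0 : 0 < d0 `^ (2 - 2 * eps) by rewrite powR_gt0.
have : B <= B / d0 `^ (2 - 2 * eps) * N.+1%:R `^ eps * delta `^ (2 - 2 * eps).
  rewrite -[leLHS](divfK (lt0r_neq0 p0)) -[leRHS]mulrA ler_wpM2l//.
    by rewrite divr_ge0// ltW.
  rewrite -[leLHS]mul1r; apply: ler_pM; rewrite ?powR_ge0//.
    by rewrite -[leLHS](powRr0 N.+1%:R) ler_powR ?ler1n// ltW.
  by apply: ge0_ler_powR; rewrite ?nnegrE//; [lra|exact: ltW..].
lra.
Qed.
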